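(* Let $(M^n,g)$, $n\ge 3$, be a Riemannian manifold with Levi-Civita connection $\nabla$, curvature tensor $R$ and Ricci tensor $S$. Let $P$ be a unit vector field on $M$ that is parallel with respect to $\nabla$, with associated 1-form $\pi(X)=g(X,P)$, and let $\bar\nabla$ be the semi-symmetric metric connection determined by $\pi$, with curvature tensor $\bar R$ and Ricci tensor $\bar S$. Suppose that $\bar R\cdot\bar S=-Q(g,\bar S)$. If $(M^n,\nabla)$ is Ricci semi-symmetric (i.e. $R\cdot S=0$), then $M$ is a quasi-Einstein manifold of the form $$S(X,Y)=(n-2)g(X,Y)-(n-2)\pi(X)\pi(Y)\quad\text{for all }X,Y.$$ Conversely, if the Ricci curvature satisfies $S(X,Y)=(n-2)g(X,Y)-(n-2)\pi(X)\pi(Y)$ for all $X,Y$, then $M$ is Ricci semi-symmetric (i.e. $R\cdot S=0$).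
   Context: The semi-symmetric metric connection determined by $\pi$ is $\bar\nabla_XY=\nabla_XY+\pi(Y)X-g(X,Y)P$. Its curvature is $\bar R(X,Y)Z=\bar\nabla_X\bar\nabla_YZ-\bar\nabla_Y\bar\nabla_XZ-\bar\nabla_{[X,Y]}Z$ and its Ricci tensor is $\bar S(Y,Z)=\operatorname{tr}(X\mapsto \bar R(X,Y)Z)$; $R$ and $S$ are defined in the same way from $\nabla$. Unit parallel means $g(P,P)=1$ and $\nabla P=0$. For a $(0,2)$-tensor $H$ and a curvature tensor $R$ (or $\bar R$), $$(R(X,Y)\cdot H)(Z,W)=-H(R(X,Y)Z,W)-H(Z,R(X,Y)W),$$ and similarly with $\bar R$. Also $$Q(g,H)(Z,W;X,Y)=-H((X\wedge_gY)Z,W)-H(Z,(X\wedge_gY)W),\qquad (X\wedge_gY)Z=g(Y,Z)X-g(X,Z)Y.$$ The condition $\bar R\cdot\bar S=-Q(g,\bar S)$ means $(\bar R(X,Y)\cdot\bar S)(Z,W)=-Q(g,\bar S)(Z,W;X,Y)$ for all $X,Y,Z,W$, and $R\cdot S=0$ means $(R(X,Y)\cdot S)(Z,W)=0$ for all $X,Y,Z,W$. A Riemannian manifold of dimension $n>2$ is quasi-Einstein if its Ricci tensor is not identically zero and satisfies $S(X,Y)=a\,g(X,Y)+b\,\eta(X)\eta(Y)$ for scalar functions $a$, $b\neq0$ and a non-zero 1-form $\eta$. *)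

(* Defs.v *)
From mathcomp Require Import all_boot all_order all_algebra.
From mathcomp Require Import all_classical all_reals topology normedtype derive.

Set Implicit Arguments.
Unset Strict Implicit.
Unset Printing Implicit Defensive.

Import Order.TTheory GRing.Theory Num.Theory numFieldNormedType.Exports.

Local Open Scope classical_set_scope.
Local Open Scope ring_scope.

(* Calculus on R^n is done on 'rV[R]_n, R : realType (MathComp-Analysis). *)

Section EuclideanSmoothness.
Context {R : realType} {n : nat}.

Definition partials (s : seq 'I_n) (f : 'rV[R]_n -> R) : 'rV[R]_n -> R :=
  foldr (fun i h => fun x => 'D_(delta_mx 0 i) h x) f s.

(* C^oo on A; only meaningful (and only used) for A open. *)
Definition Cinfty_on (A : set 'rV[R]_n) (f : 'rV[R]_n -> R) : Prop :=
  forall (s : seq 'I_n) (x : 'rV[R]_n), A x ->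
    {for x, continuous (partials s f)} /\
    (forall i, derivable (partials s f) x (delta_mx 0 i)).

End EuclideanSmoothness.

(* A smooth manifold without boundary of dimension n.  chart_at singles out,
   for each point, one chart of the atlas around it. *)
Record manifold (R : realType) (n : nat) := Manifold {
  points :> topologicalType;
  points_nonempty : [set: points] !=set0;
  points_hausdorff : hausdorff_space points;
  points_second_countable : second_countable (T := points);
  chart : Type;
  dom : chart -> set points;
  phi : chart -> points -> 'rV[R]_n;
  psi : chart -> 'rV[R]_n -> points;
  chart_at : points -> chart;
  chart_atP : forall p, dom (chart_at p) p;
  dom_open : forall c, open (dom c);
  codom_open : forall c, open (phi c @` dom c);
  phiK : forall c p, dom c p -> psi c (phi c p) = p;
  phi_continuous : forall c, {in dom c, continuous (phi c)};
  psi_continuous : forall c, {in phi c @` dom c, continuous (psi c)};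
  transition_smooth : forall (c d : chart) (k : 'I_n),
    Cinfty_on (phi c @` (dom c `&` dom d)) (fun x => phi d (psi c x) 0 k)
}.

Section Manifold.
Context {R : realType} {n : nat} {M : manifold R n}.

(* The tangent space at p is identified with R^n by means of the coordinate
   basis of chart_at p: a (not necessarily smooth) vector field is a function
   X : M -> 'rV[R]_n, X p being the coordinate vector of the tangent vector at p
   in chart_at p. *)

(* X F = dF(X), the derivative of F along X. *)
Definition along (V : normedModType R) (X : M -> 'rV[R]_n) (F : M -> V) : M -> V :=
  fun p => 'D_(X p) (F \o psi (chart_at p)) (phi (chart_at p) p).

Definition smooth_on (U : set M) (f : M -> R) : Prop :=
  forall c : chart M, Cinfty_on (phi c @` (U `&` dom c)) (f \o psi c).

(* The k-th component of X in a chart c is X (phi_c^k). *)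
Definition vfield_on (U : set M) (X : M -> 'rV[R]_n) : Prop :=
  forall (c : chart M) (k : 'I_n),
    Cinfty_on (phi c @` (U `&` dom c))
      (fun x => along X (phi c) (psi c x) 0 k).

(* [X, Y] f = X (Y f) - Y (X f), for f ranging over the coordinate functions of
   chart_at p. *)
Definition bracket (X Y : M -> 'rV[R]_n) : M -> 'rV[R]_n := fun p =>
  let x := phi (chart_at p) in along X (along Y x) p - along Y (along X x) p.

(* The i-th coordinate vector field of the chart c, a vector field on dom c. *)
Definition coord_field (c : chart M) (i : 'I_n) : M -> 'rV[R]_n := fun q =>
  'D_(delta_mx 0 i) (phi (chart_at q) \o psi c) (phi c q).

(* A 1-form is given by its components in the basis dual to that of chart_at p. *)
Definition pairing (w : M -> 'cV[R]_n) (X : M -> 'rV[R]_n) : M -> R :=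
  fun p => (X p *m w p) 0 0.

Definition one_form (w : M -> 'cV[R]_n) : Prop :=
  forall (U : set M) X, open U -> vfield_on U X -> smooth_on U (pairing w X).

End Manifold.

(* gram p is the Gram matrix of g_p in the coordinate basis of chart_at p. *)
Record metric (R : realType) (n : nat) (M : manifold R n) := Metric {
  gram : M -> 'M[R]_n;
  gram_sym : forall p, (gram p)^T = gram p;
  gram_pos : forall p (v : 'rV[R]_n), v != 0 -> 0 < (v *m gram p *m v^T) 0 0;
  gram_smooth : forall (U : set M) (X Y : M -> 'rV[R]_n),
    open U -> vfield_on U X -> vfield_on U Y ->
    smooth_on U (fun p => (X p *m gram p *m (Y p)^T) 0 0)
}.

Section Riemannian.
Context {R : realType} {n : nat} {M : manifold R n}.

Local Notation vf := (M -> 'rV[R]_n).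

Definition inner (g : metric M) (X Y : vf) : M -> R :=
  fun p => (X p *m gram g p *m (Y p)^T) 0 0.

(* w(X) = g(X, V) *)
Definition flat (g : metric M) (V : vf) : M -> 'cV[R]_n :=
  fun p => gram g p *m (V p)^T.

(* Connections act on vector fields defined on open subsets, compatibly with
   restriction; the values on functions that are not smooth vector fields near
   the point under consideration are irrelevant. *)
Record affine_connection (nabla : vf -> vf -> vf) : Prop := {
  conn_local : forall (U : set M) (X X' Y Y' : vf), open U ->
    vfield_on U X -> vfield_on U Y ->
    {in U, X =1 X'} -> {in U, Y =1 Y'} -> {in U, nabla X Y =1 nabla X' Y'};
  conn_smooth : forall (U : set M) (X Y : vf), open U ->
    vfield_on U X -> vfield_on U Y -> vfield_on U (nabla X Y);
  conn_addl : forall (U : set M) (X X' Y : vf), open U ->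
    vfield_on U X -> vfield_on U X' -> vfield_on U Y ->
    {in U, nabla (fun p => X p + X' p) Y =1
           fun p => nabla X Y p + nabla X' Y p};
  conn_scalel : forall (U : set M) (f : M -> R) (X Y : vf), open U ->
    smooth_on U f -> vfield_on U X -> vfield_on U Y ->
    {in U, nabla (fun p => f p *: X p) Y =1 fun p => f p *: nabla X Y p};
  conn_addr : forall (U : set M) (X Y Y' : vf), open U ->
    vfield_on U X -> vfield_on U Y -> vfield_on U Y' ->
    {in U, nabla X (fun p => Y p + Y' p) =1
           fun p => nabla X Y p + nabla X Y' p};
  conn_leibniz : forall (U : set M) (f : M -> R) (X Y : vf), open U ->
    smooth_on U f -> vfield_on U X -> vfield_on U Y ->
    {in U, nabla X (fun p => f p *: Y p) =1
           fun p => along X f p *: Y p + f p *: nabla X Y p}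
}.

Record levi_civita (g : metric M) (nabla : vf -> vf -> vf) : Prop := {
  lc_connection : affine_connection nabla;
  lc_torsion_free : forall (U : set M) (X Y : vf), open U ->
    vfield_on U X -> vfield_on U Y ->
    {in U, (fun p => nabla X Y p - nabla Y X p) =1 bracket X Y};
  lc_metric : forall (U : set M) (X Y Z : vf), open U ->
    vfield_on U X -> vfield_on U Y -> vfield_on U Z ->
    {in U, along X (inner g Y Z) =1
           fun p => inner g (nabla X Y) Z p + inner g Y (nabla X Z) p}
}.

Definition unit_field (g : metric M) (P : vf) : Prop :=
  forall p, inner g P P p = 1.

Definition parallel (nabla : vf -> vf -> vf) (P : vf) : Prop :=
  forall (U : set M) (X : vf), open U -> vfield_on U X ->
    {in U, forall p, nabla X P p = 0}.

Definition semi_symmetric_metric_connection (g : metric M)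
    (nabla : vf -> vf -> vf) (P : vf) : vf -> vf -> vf :=
  fun X Y p =>
    nabla X Y p + pairing (flat g P) Y p *: X p - inner g X Y p *: P p.

Definition curvature (D : vf -> vf -> vf) (X Y Z : vf) : vf :=
  fun p => D X (D Y Z) p - D Y (D X Z) p - D (bracket X Y) Z p.

(* tr (X |-> R(X, Y) Z) at p, in the coordinate basis of chart_at p. *)
Definition ricci (D : vf -> vf -> vf) (Y Z : vf) : M -> R := fun p =>
  \tr (\matrix_(i < n) curvature D (coord_field (chart_at p) i) Y Z p).

(* (A . H)(Z, W) for A : Z |-> R(X, Y) Z or A : Z |-> (X /\_g Y) Z. *)
Definition act (A : vf -> vf) (H : vf -> vf -> M -> R) (Z W : vf) : M -> R :=
  fun p => - H (A Z) W p - H Z (A W) p.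

Definition wedge (g : metric M) (X Y Z : vf) : vf :=
  fun p => inner g Y Z p *: X p - inner g X Z p *: Y p.

Definition curv_dot (D : vf -> vf -> vf) (H : vf -> vf -> M -> R)
    (X Y Z W : vf) : M -> R := act (curvature D X Y) H Z W.

Definition Qtensor (g : metric M) (H : vf -> vf -> M -> R)
    (Z W X Y : vf) : M -> R := act (wedge g X Y) H Z W.

(* Tensor identities are stated for vector fields on arbitrary open subsets
   (in particular on M itself). *)

Definition ricci_semisymmetric (D : vf -> vf -> vf) : Prop :=
  forall (U : set M) (X Y Z W : vf), open U ->
    vfield_on U X -> vfield_on U Y -> vfield_on U Z -> vfield_on U W ->
    {in U, forall p, curv_dot D (ricci D) X Y Z W p = 0}.

Definition curv_ricci_eq_opp_Q (g : metric M) (D : vf -> vf -> vf) : Prop :=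
  forall (U : set M) (X Y Z W : vf), open U ->
    vfield_on U X -> vfield_on U Y -> vfield_on U Z -> vfield_on U W ->
    {in U, forall p,
      curv_dot D (ricci D) X Y Z W p = - Qtensor g (ricci D) Z W X Y p}.

(* S = a g + b (w (x) w) *)
Definition ricci_form (g : metric M) (S : vf -> vf -> M -> R)
    (a b : M -> R) (w : M -> 'cV[R]_n) : Prop :=
  forall (U : set M) (X Y : vf), open U -> vfield_on U X -> vfield_on U Y ->
    {in U, forall p,
      S X Y p = a p * inner g X Y p + b p * (pairing w X p * pairing w Y p)}.

Definition quasi_Einstein (g : metric M) (S : vf -> vf -> M -> R) : Prop :=
  [/\ (2 < n)%N,
      exists (U : set M) (X Y : vf) (p : M),
        [/\ open U, vfield_on U X, vfield_on U Y, U p & S X Y p <> 0]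
    & exists (a b : M -> R) (w : M -> 'cV[R]_n),
        [/\ smooth_on setT a /\ smooth_on setT b,
            forall p, b p <> 0,
            one_form w /\ (forall p, w p <> 0)
          & ricci_form g S a b w]].

End Riemannian.

(* Main.v *)
(** Write [h = g - pi (x) pi].  Since [P] is parallel, the connection [nabla-bar]
has curvature [R(X,Y)Z - (h(Y,Z)X' - h(X,Z)Y')], where [X'] is the component of
[X] orthogonal to [P]; tracing, its Ricci tensor is [S - (n-2)h].  Evaluate the
hypothesis [Rbar.Sbar = -Q(g,Sbar)] on [(X, P; P, W)]: as [R(X,P)P = 0] and
[Rbar(X,P)W = R(X,P)W], semisymmetry kills the left-hand side, and the right-hand
side reads [Sbar(X,W) = pi(X)S(P,W) - pi(W)S(P,X)].  Taking [W = P] gives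
[S(P,X) = 0], whence [Sbar = 0].  Conversely every curvature operator of [nabla]
is skew for [g] and kills [P], so it annihilates [h].

Skewness rests on [[X,Y]f = X(Yf) - Y(Xf)], that is on the symmetry of second
partial derivatives; smoothness and function-linearity of the bracket are read
off from [[X,Y] = nabla_X Y - nabla_Y X]. *)

From HB Require Import structures.
Require Import Defs.
From mathcomp Require Import all_boot all_order all_algebra.
From mathcomp Require Import all_classical all_reals topology normedtype derive.
From mathcomp Require Import landau ring lra.
Import Order.TTheory GRing.Theory Num.Theory numFieldNormedType.Exports.
Local Open Scope classical_set_scope.
Local Open Scope ring_scope.

Set Implicit Arguments.
Unset Strict Implicit.
Unset Printing Implicit Defensive.

(** * Directional derivatives *)

(** Two features of the setting shape the proof. A tangent vector at [p] is stored in the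
    coordinates of [chart_at p], and that chart may jump with [p]; a field must be rewritten in one
    fixed chart before it is differentiated, which takes the full chain rule. As [Cinfty_on] speaks
    of partial derivatives only, total differentiability has to be derived from it. Secondly,
    curvature and Ricci tensors are operations on vector fields, not on tangent vectors, and the
    hypotheses feed them fields such as [R(X,P)W] or [X - pi(X)P]; hence the work on locality and
    function-linearity in the slots that are not traced over.

    The arguments [(X, P; P, W)] are chosen because [h(P, .) = 0] and [P] has no component
    orthogonal to itself, so every correction term of [Rbar(X,P)] disappears. While [S(X,P) = 0] is
    immediate from [R(., X)P = 0], the relation with the arguments exchanged is what the hypothesis
    must supply. *)

Section DirectionalDerivatives.
Context {R : realType} {V : normedModType R}.
Implicit Types (f : V -> R) (x v : V).

Lemma is_derive_line f x v (t : R) : derivable f (t *: v + x) v ->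
  is_derive t (1 : R) (fun s : R => f (s *: v + x)) ('D_v f (t *: v + x)).
Proof.
move=> df.
have E : (fun h : R => h^-1 *: (f ((h *: (1 : R) + t) *: v + x) - f (t *: v + x)))
    = (fun h : R => h^-1 *: (f (h *: v + (t *: v + x)) - f (t *: v + x))).
  by apply/funext => h; rewrite [h *: (1 : R)]mulr1 scalerDl addrA.
apply: DeriveDef; first by rewrite /derivable /= E.
by rewrite /derive /= E.
Qed.

(** The range [|c| <= |t|] is symmetric so that one statement serves increments of either sign; the
    proof splits on the sign to get an oriented interval. *)
Lemma MVT_direction f x v (t : R) :
  (forall c : R, `|c| <= `|t| -> derivable f (c *: v + x) v) ->
  exists2 c : R, `|c| <= `|t| & f (t *: v + x) - f x = t * 'D_v f (c *: v + x).
Proof.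
move=> df; pose F (s : R) := f (s *: v + x).
have dF (s : R) : `|s| <= `|t| -> is_derive s (1 : R) F ('D_v f (s *: v + x)).
  by move=> /df; exact: is_derive_line.
have F0 : F 0 = f x by rewrite /F scale0r add0r.
case: (leP 0 t) => t0.
  have H (s : R) : s \in `[0, t] -> `|s| <= `|t|.
    by rewrite in_itv /= => /andP[s0 st]; rewrite !ger0_norm.
  have [||c /H ct E] := @MVT_segment R F (fun s => 'D_v f (s *: v + x)) 0 t t0.
  - by move=> s /subset_itv_oo_cc /H /dF.
  - apply: derivable_within_continuous => s /H /dF ds.
    exact: ex_derive.
  by exists c => //; rewrite -F0 -/(F t) E subr0 mulrC.
have H (s : R) : s \in `[t, 0] -> `|s| <= `|t|.
  by rewrite in_itv /= => /andP[ts s0]; rewrite !ler0_norm ?lerN2 // ltW.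
have [||c /H ct E] := @MVT_segment R F (fun s => 'D_v f (s *: v + x)) t 0 (ltW t0).
- by move=> s /subset_itv_oo_cc /H /dF.
- apply: derivable_within_continuous => s /H /dF ds.
  exact: ex_derive.
exists c => //; rewrite -F0 -/(F t) -[LHS]opprB E; ring.
Qed.

Lemma continuous_dist f x (e : R) : {for x, continuous f} -> 0 < e ->
  exists2 d : R, 0 < d & forall y, `|y - x| < d -> `|f y - f x| < e.
Proof.
move=> /cvgrPdist_lt /(_ e) + e0 => /(_ e0) /nbhs_ballP[d /= d0 H].
exists d => // y yx; rewrite distrC; apply: H.
by rewrite -ball_normE /= distrC.
Qed.

Lemma near_dist (P : set V) x : nbhs x P ->
  exists2 d : R, 0 < d & forall y, `|y - x| < d -> P y.
Proof.
move=> /nbhs_ballP[d /= d0 H]; exists d => // y yx; apply: H.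
by rewrite -ball_normE /= distrC.
Qed.

(* Both iterated derivatives are limits of the same second difference. *)
Lemma derive_comm f x u v :
  (\forall y \near x, [/\ derivable f y u, derivable f y v,
     derivable ('D_u f) y v & derivable ('D_v f) y u]) ->
  {for x, continuous ('D_v ('D_u f))} -> {for x, continuous ('D_u ('D_v f))} ->
  'D_v ('D_u f) x = 'D_u ('D_v f) x.
Proof.
(* Used with [k], [l] the two mixed derivatives at [x], and [c] a value that both mixed derivatives
   take at points near [x]. *)
have far (k l c : R) : `|c - k| < `|k - l| / 2 -> `|c - l| < `|k - l| / 2 -> False.
  rewrite distrC => ck cl; have := ltrD ck cl; rewrite -splitr ltNge => /negP.
  by apply; exact: ler_distD.
move=> /near_dist[r r0 near_x] cvu cuv.
apply/eqP; rewrite -subr_eq0 -normr_eq0; apply/negPn/negP => ne0.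
have e0 : 0 < `|'D_v ('D_u f) x - 'D_u ('D_v f) x| / 2.
  by rewrite divr_gt0 // lt_def ne0 normr_ge0.
have [d1 d10 H1] := continuous_dist cvu e0.
have [d2 d20 H2] := continuous_dist cuv e0.
pose m : R := Num.min r (Num.min d1 d2).
have m0 : 0 < m by rewrite /m !lt_min r0 d10 d20.
have K0 : 0 < `|u| + `|v| + 1.
  by rewrite ltr_wpDl // addr_ge0.
(* Small enough that [a u + b v + x] stays within [m] of [x] for [|a|, |b| <= t]; the [+ 1] keeps
   the denominator positive when [u] and [v] vanish. *)
pose t : R := m / (`|u| + `|v| + 1).
have t0 : 0 < t by rewrite divr_gt0.
have small (a b : R) : `|a| <= t -> `|b| <= t -> `|a *: u + b *: v + x - x| < m.
  move=> at_ bt; rewrite addrK (le_lt_trans (ler_normD _ _)) // !normrZ.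
  rewrite (@le_lt_trans _ _ (t * (`|u| + `|v|))) //.
    by rewrite mulrDr lerD // ler_wpM2r.
  by rewrite -[ltRHS](divfK (lt0r_neq0 K0)) ltr_pM2l // ltrDl.
have D (a b : R) : `|a| <= t -> `|b| <= t ->
   [/\ derivable f (a *: u + b *: v + x) u, derivable f (a *: u + b *: v + x) v,
     derivable ('D_u f) (a *: u + b *: v + x) v &
     derivable ('D_v f) (a *: u + b *: v + x) u].
  move=> at_ bt; apply: near_x; apply: (lt_le_trans (small _ _ at_ bt)).
  by rewrite ge_min lexx.
have tE : `|t| = t by rewrite ger0_norm // ltW.
have zt : `|(0 : R)| <= t by rewrite normr0 ltW.
(* the second difference, with the increment along [w'] taken first *)
have second_diff (w w' : V) :
    (forall a b : R, `|a| <= t -> `|b| <= t -> derivable f (a *: w + (b *: w' + x)) w) ->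
    (forall a b : R, `|a| <= t -> `|b| <= t ->
       derivable ('D_w f) (b *: w' + (a *: w + x)) w') ->
    exists a b : R, [/\ `|a| <= t, `|b| <= t &
      f (t *: w + (t *: w' + x)) - f (t *: w' + x) - (f (t *: w + x) - f x)
       = t * (t * 'D_w' ('D_w f) (b *: w' + (a *: w + x)))].
  move=> Dw Dww'.
  (* The second difference is the increment of [G] along [w]. The mean value theorem for [G] along
     [w] gives [a]; for ['D_w f] along [w'] it gives [b]. *)
  pose G y := f (t *: w' + y) - f y.
  have shift_derivable (y : V) : derivable f (t *: w' + y) w ->
      is_derive y w (fun z => f (t *: w' + z)) ('D_w f (t *: w' + y)).
    move=> df.
    have E : (fun h : R => h^-1 *: (f (t *: w' + (h *: w + y)) - f (t *: w' + y)))
      = (fun h : R => h^-1 *: (f (h *: w + (t *: w' + y)) - f (t *: w' + y))).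
      by apply/funext => h; rewrite addrCA.
    by apply: DeriveDef; rewrite ?/derivable ?/derive /= E.
  have DG (a : R) : `|a| <= t -> is_derive (a *: w + x) w G
      ('D_w f (t *: w' + (a *: w + x)) - 'D_w f (a *: w + x)).
    move=> at_; rewrite /G.
    have h1 := shift_derivable (a *: w + x).
    have /h1 h2 : derivable f (t *: w' + (a *: w + x)) w.
      by rewrite addrCA; apply: Dw; rewrite ?tE.
    have h3 : derivable f (a *: w + x) w.
      by rewrite -[x]add0r -(scale0r w'); exact: Dw.
    have := @is_deriveB _ _ _ (fun z => f (t *: w' + z)) f _ _ _ _ h2 (derivableP h3).
    by rewrite /GRing.sub_fun.
  have [|a] := @MVT_direction G x w t.
    by move=> c; rewrite tE => ct; have [] := DG c ct.
  rewrite tE => at_ GE.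
  have [|b] := @MVT_direction ('D_w f) (a *: w + x) w' t.
    by move=> c; rewrite tE => ct; apply: Dww'.
  rewrite tE => bt DE.
  exists a, b; split=> //; rewrite -DE.
  have := DG a at_ => /@derive_val <-; rewrite -GE /G.
  by rewrite [t *: w' + (t *: w + x)]addrCA; ring.
have [a b at_ bt|a b at_ bt|a [b [at_ bt E1]]] := second_diff u v.
- by rewrite addrA; case: (D a b at_ bt) => + _ _ _.
- by rewrite addrCA addrA; case: (D a b at_ bt) => _ _ + _.
have [a' b' at' bt'|a' b' at' bt'|a' [b' [at' bt' E2]]] := second_diff v u.
- by rewrite addrCA addrA; case: (D b' a' bt' at') => _ + _ _.
- by rewrite addrA; case: (D b' a' bt' at') => _ _ _ +.
have tv : t *: v + (t *: u + x) = t *: u + (t *: v + x) by rewrite addrCA.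
(* Exchanging [u] and [v] only swaps the two middle terms of the second difference, and the factor
   [t] can be cancelled twice. *)
have swap (p q p' q' k l : R) : p - q - (p' - q') = t * (t * k) ->
    p - p' - (q - q') = t * (t * l) -> k = l.
  move=> kE lE; do 2 apply: (mulfI (lt0r_neq0 t0)).
  by rewrite -kE -lE; ring.
rewrite tv in E2; have E := swap _ _ _ _ _ _ E1 E2.
have near1 : `|b *: v + (a *: u + x) - x| < d1.
  rewrite addrCA addrA; apply: (lt_le_trans (small _ _ at_ bt)).
  by rewrite !ge_min lexx orbT.
have near2 : `|b' *: u + (a' *: v + x) - x| < d2.
  rewrite addrA; apply: (lt_le_trans (small _ _ bt' at')).
  by rewrite !ge_min lexx !orbT.
by apply: (far _ _ _ (H1 _ near1)); rewrite E; exact: H2.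
Qed.

End DirectionalDerivatives.

(** * Total differentiability from continuous partial derivatives, and the chain rule *)

Section CoordinateDerivatives.
Context {R : realType}.

Lemma normr_coord_le m (v : 'rV[R]_m) i : `|v 0 i| <= `|v|.
Proof.
by rewrite [leRHS]/Num.Def.normr /= mx_normrE; exact: (le_bigmax _ _ (0, i)).
Qed.

Lemma normr_rV_le m (v : 'rV[R]_m) (e : R) : 0 <= e ->
  (forall i, `|v 0 i| <= e) -> `|v| <= e.
Proof.
move=> e0 ve; rewrite [leLHS]/Num.Def.normr /= mx_normrE bigmax_le // => -[i j] _.
by rewrite ord1.
Qed.

(** [differentiable] refers to a differential picked by choice; exhibiting one continuous linear map
    with the right expansion shows that the choice succeeds. *)
Lemma differentiable_littleo (V W : normedModType R) (f : V -> W)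
    (df : {linear V -> W}) x : continuous df ->
  f = (fun y => f x + df (y - x)) +o_ x (fun y => y - x) ->
  differentiable f x.
Proof.
move=> dfc o; apply/diffP => /=.
apply: (@getPex _ (fun (df : {linear V -> W}) => continuous df /\
  forall y, f y = f (lim (nbhs x)) + df (y - lim (nbhs x))
                  +o_(y \near x) (y - lim (nbhs x)))).
exists df; split=> //; apply: eqaddoEx => y.
by rewrite lim_id //; exact: (congr1 (@^~ y) o).
Qed.

(** The increment from [x] to [x + h] telescopes along the truncations of [h]. Consecutive
    truncations differ in one coordinate, where the mean value theorem and continuity of that
    partial derivative bound the error. *)
Lemma differentiable_C1 m (f : 'rV[R]_m -> R) x :
  (forall i, \forall y \near x, derivable f y (delta_mx 0 i)) ->
  (forall i, {for x, continuous ('D_(delta_mx 0 i) f)}) ->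
  differentiable f x.
Proof.
move=> df cf; pose D i := 'D_(delta_mx 0 i) f.
pose L (h : 'rV[R]_m) := \sum_i h 0 i * D i x.
have Llin : linear L.
  move=> a u v; rewrite /L scaler_sumr -big_split /=; apply: eq_bigr => i _.
  by rewrite !mxE mulrDl -mulrA.
pose L' : {linear 'rV[R]_m -> R} := HB.pack L (GRing.isLinear.Build _ _ _ _ L Llin).
have Lcont : continuous L'.
  move=> y; apply: differentiable_continuous.
  rewrite (_ : L' = \sum_i (fun h : 'rV[R]_m => h 0 i * D i x) :> (_ -> _)); last first.
    by apply/funext => h; rewrite fct_sumE.
  apply: differentiable_sum => i; apply: differentiableM.
    exact: differentiable_coord.
  exact: differentiable_cst.
apply: (differentiable_littleo (df := L')) => //.
apply/eqaddoP => e e0.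
(* Each of the [m] coordinate steps may cost [e' * |h|]; [m.+1] instead of [m] keeps the quotient
   meaningful in dimension zero. *)
pose e' : R := e / m.+1%:R.
have e'0 : 0 < e' by rewrite divr_gt0.
have : \forall y \near x, forall i, derivable f y (delta_mx 0 i) /\ `|D i y - D i x| <= e'.
  apply: (@filter_forall _ 'I_m (fun i y => derivable f y (delta_mx 0 i) /\ `|D i y - D i x| <= e') (nbhs x)).
  move=> i; near=> y; split; first by near: y; exact: df.
  rewrite distrC; near: y; move/cvgrPdist_le : (cf i); exact.
move=> /near_dist[r r0 near_x].
apply/nbhs_ballP; exists r => // y; rewrite -ball_normE /= distrC => yx.
rewrite !fctE /= /L; have [h hE] : {h | h = y - x} by exists (y - x).
rewrite -!hE in yx *.
pose trunc k : 'rV[R]_m := \row_i (if (i < k)%N then h 0 i else 0).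
have truncS (k : 'I_m) : trunc k.+1 = h 0 k *: delta_mx 0 k + trunc k.
  apply/rowP => i; rewrite !mxE eqxx /= ltnS leq_eqVlt -val_eqE.
  by case: ltngtP => //= [_|_|/val_inj ->]; rewrite ?mulr0 ?mulr1 ?add0r ?addr0.
have step (k : 'I_m) : `|f (trunc k.+1 + x) - f (trunc k + x) - h 0 k * D k x| <= e' * `|h|.
  (* The norm is the maximum of the coordinates, so a vector bounded coordinatewise by [h] stays in
     the ball. *)
  have nbr (c : R) : `|c| <= `|h 0 k| -> `|c *: delta_mx 0 k + (trunc k + x) - x| < r.
    move=> ch; rewrite addrA addrK (le_lt_trans _ yx) // normr_rV_le // => i.
    rewrite !mxE eqxx /= -val_eqE; case: ltngtP => /= _.
    - by rewrite mulr0 add0r; apply: normr_coord_le.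
    - by rewrite mulr0 addr0 normr0.
    - by rewrite mulr1 addr0 (le_trans ch) // normr_coord_le.
  rewrite truncS -[_ + trunc k + x]addrA; have [|c ch ->] := @MVT_direction _ _ f (trunc k + x) (delta_mx 0 k) (h 0 k).
    by move=> c /nbr /near_x /(_ k)[].
  rewrite -mulrBr normrM mulrC ler_pM //.
    by have [] := near_x _ (nbr _ ch) k.
  exact: normr_coord_le.
have -> : f y - (f x + \sum_i h 0 i * D i x)
   = \sum_(k < m) (f (trunc k.+1 + x) - f (trunc k + x) - h 0 k * D k x).
  rewrite sumrB opprD addrA; congr (_ - _).
  rewrite -(big_mkord xpredT (fun k => f (trunc k.+1 + x) - f (trunc k + x))).
  rewrite (telescope_sumr (fun k => f (trunc k + x))) //.
  have -> : trunc m = h by apply/rowP => i; rewrite mxE ltn_ord.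
  have -> : trunc 0%N = 0 by apply/rowP => i; rewrite !mxE.
  by rewrite hE subrK add0r.
rewrite (le_trans (ler_norm_sum _ _ _)) //.
rewrite (le_trans (ler_sum _ (fun k _ => step k))) //.
rewrite sumr_const card_ord -mulr_natl mulrA ler_wpM2r //.
by rewrite /e' mulrA ler_pdivrMr // [_ * e]mulrC ler_wpM2l ?ler_nat // ltW.
Unshelve. all: by end_near. Qed.

Lemma derive_comp (U V W : normedModType R) (f : U -> V) (g : V -> W) x v :
  differentiable f x -> differentiable g (f x) ->
  'D_v (g \o f) x = 'D_('D_v f x) g (f x).
Proof.
move=> df dg; rewrite !deriveE //; last exact: differentiable_comp.
by rewrite diff_comp.
Qed.

Lemma derive_linear (U V : normedModType R) (f : U -> V) x (a : R) u v :
  differentiable f x -> 'D_(a *: u + v) f x = a *: 'D_u f x + 'D_v f x.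
Proof. by move=> df; rewrite !deriveE // linearP. Qed.

Lemma derive_subv (U V : normedModType R) (f : U -> V) x u v :
  differentiable f x -> 'D_(u - v) f x = 'D_u f x - 'D_v f x.
Proof. by move=> df; rewrite !deriveE // linearB. Qed.

Lemma derive_sum_partials m (V : normedModType R) (f : 'rV[R]_m -> V) x v :
  differentiable f x -> 'D_v f x = \sum_i v 0 i *: 'D_(delta_mx 0 i) f x.
Proof.
move=> df; rewrite !deriveE // [in LHS](row_sum_delta v) linear_sum.
by apply: eq_bigr => i _; rewrite linearZ deriveE.
Qed.

Lemma differentiable_rV m (V : normedModType R) (f : V -> 'rV[R]_m) x :
  (forall i, differentiable (fun y => f y 0 i) x) -> differentiable f x.
Proof.
move=> df; have -> : f = \sum_i (fun y => f y 0 i *: (delta_mx 0 i : 'rV[R]_m)).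
  by apply/funext => y; rewrite fct_sumE -row_sum_delta.
by apply: differentiable_sum => i; apply: differentiableZl.
Qed.

Lemma derive_coord m (V : normedModType R) (f : V -> 'rV[R]_m) x v i :
  differentiable f x -> 'D_v f x 0 i = 'D_v (fun y => f y 0 i) x.
Proof. by move=> df; rewrite derive_mx ?mxE //; exact: diff_derivable. Qed.

End CoordinateDerivatives.

(** * Smooth functions on open subsets of R^n *)

Section FiniteSmoothness.
Context {R : realType} {n : nat}.
Implicit Types (A B : set 'rV[R]_n) (f g : 'rV[R]_n -> R).

Local Notation "'pd_ i f" := ('D_(delta_mx 0 i) f) (at level 10, i at level 1, f at level 9).

(* Inductions run over the number m of derivatives, with Cinfty_on recovered
   as the conjunction over all m. *)
Definition Ck_on (m : nat) A f := forall s : seq 'I_n, (size s <= m)%N ->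
  forall x, A x -> {for x, continuous (partials s f)} /\
    (forall i, derivable (partials s f) x (delta_mx 0 i)).

Lemma Cinfty_onE A f : Cinfty_on A f <-> forall m, Ck_on m A f.
Proof.
by split=> [fA m s _|fA s]; [exact: fA|exact: (fA (size s) s (leqnn _))].
Qed.

Lemma Cinfty_on_sub A B f : A `<=` B -> Cinfty_on B f -> Cinfty_on A f.
Proof. by move=> AB fB s x /AB; apply: fB. Qed.

Lemma Ck_on_le m m' A f : (m <= m')%N -> Ck_on m' A f -> Ck_on m A f.
Proof. by move=> mm' fA s sm; apply: fA; exact: leq_trans mm'. Qed.

Lemma near_open A f g x : open A -> (forall y, A y -> f y = g y) -> A x ->
  \forall y \near x, f y = g y.
Proof.
by move=> oA fg Ax; near=> y; apply: fg; near: y; exact: open_nbhs_nbhs.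
Unshelve. all: by end_near. Qed.

Lemma partials_eq A f g : open A -> (forall y, A y -> f y = g y) ->
  forall s x, A x -> partials s f x = partials s g x.
Proof.
move=> oA fg; elim=> [|i s IH] x Ax; first exact: fg.
by apply: near_eq_derive; apply: near_open IH Ax.
Qed.

Lemma Ck_on_eq m A f g : open A -> (forall y, A y -> f y = g y) ->
  Ck_on m A f -> Ck_on m A g.
Proof.
move=> oA fg fA s sm x Ax; have [cf df] := fA s sm x Ax.
have E := near_open oA (partials_eq oA fg s) Ax.
split=> [|i]; last exact: near_eq_derivable (df i).
rewrite /prop_for /continuous_at -(partials_eq oA fg s Ax).
exact: cvg_trans (near_eq_cvg E) cf.
Qed.

Lemma Cinfty_on_eq A f g : open A -> (forall y, A y -> f y = g y) ->
  Cinfty_on A f -> Cinfty_on A g.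
Proof.
by move=> oA fg /Cinfty_onE fA; apply/Cinfty_onE => m; exact: Ck_on_eq (fA m).
Qed.

(** The head of the list is differentiated last, so the recursion peels off the last index. This
    lets a product or composite be differentiated once, leaving the rest to an induction
    hypothesis. *)
Lemma Ck_onS m A f :
  Ck_on m.+1 A f <-> Ck_on 0 A f /\ forall i, Ck_on m A ('pd_i f).
Proof.
have partials_rcons s i : partials (rcons s i) f = partials s ('pd_i f).
  by rewrite /partials foldr_rcons.
split=> [fA|[f0 fA] s].
  split=> [|i s sm]; first exact: Ck_on_le fA.
  by rewrite -partials_rcons; apply: fA; rewrite size_rcons.
case/lastP: s => [_|s i]; first exact: f0.
by rewrite size_rcons ltnS partials_rcons; exact: fA.
Qed.

Lemma Ck_on0 A f : (forall x, A x -> {for x, continuous f} /\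
   forall i, derivable f x (delta_mx 0 i)) <-> Ck_on 0 A f.
Proof.
split=> fA; last exact: (fA [::] (leqnn _)).
by move=> s; rewrite leqn0 => /nilP ->; exact: fA.
Qed.

Lemma Cinfty_on_partial A f i : Cinfty_on A f -> Cinfty_on A ('pd_i f).
Proof.
move=> /Cinfty_onE fA; apply/Cinfty_onE => m.
by have /Ck_onS[_] := fA m.+1; apply.
Qed.

Lemma Cinfty_on_continuous A f x : Cinfty_on A f -> A x -> {for x, continuous f}.
Proof. by move=> fA /(fA [::])[]. Qed.

Lemma Cinfty_on_derivable A f x i : Cinfty_on A f -> A x ->
  derivable f x (delta_mx 0 i).
Proof. by move=> fA /(fA [::])[]. Qed.

Lemma Cinfty_on_differentiable A f x : open A -> Cinfty_on A f -> A x ->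
  differentiable f x.
Proof.
move=> oA fA Ax; apply: differentiable_C1 => i; last first.
  exact: Cinfty_on_continuous (Cinfty_on_partial i fA) Ax.
near=> y; apply: (Cinfty_on_derivable (i:=i) fA).
by near: y; exact: open_nbhs_nbhs.
Unshelve. all: by end_near. Qed.

Lemma Cinfty_on_partialC A f x i j : open A -> Cinfty_on A f -> A x ->
  'pd_i ('pd_j f) x = 'pd_j ('pd_i f) x.
Proof.
move=> oA fA Ax; apply: derive_comm.
- near=> y; have Ay : A y by near: y; exact: open_nbhs_nbhs.
  split.
  + exact: (Cinfty_on_derivable (i:=j) fA Ay).
  + exact: (Cinfty_on_derivable (i:=i) fA Ay).
  + exact: (Cinfty_on_derivable (i:=i) (Cinfty_on_partial j fA) Ay).
  + exact: (Cinfty_on_derivable (i:=j) (Cinfty_on_partial i fA) Ay).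
- exact: (Cinfty_on_continuous (Cinfty_on_partial i (Cinfty_on_partial j fA)) Ax).
- exact: (Cinfty_on_continuous (Cinfty_on_partial j (Cinfty_on_partial i fA)) Ax).
Unshelve. all: by end_near. Qed.

Lemma partials_cst (s : seq 'I_n) (c : R) :
  partials s (cst c) = cst (if s is [::] then c else 0).
Proof.
elim: s => //= i s ->; apply/funext => x.
by case: s => [|j s]; rewrite derive_cst.
Qed.

Lemma Cinfty_on_cst A (c : R) : Cinfty_on A (cst c).
Proof.
move=> s x _; rewrite partials_cst.
by split=> [|i]; [exact: cst_continuous|exact: derivable_cst].
Qed.

Lemma Ck_onD m A f g : open A -> Ck_on m A f -> Ck_on m A g ->
  Ck_on m A (fun x => f x + g x).
Proof.
move=> oA; elim: m f g => [|m IH] f g.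
  move=> /Ck_on0 fA /Ck_on0 gA; apply/Ck_on0 => x Ax.
  have [[cf df] [cg dg]] := (fA x Ax, gA x Ax).
  by split=> [|i]; [exact: (cvgD cf cg)|exact: (derivableD (df i) (dg i))].
move=> fA gA; have /Ck_onS[/Ck_on0 f0 fS] := fA; have /Ck_onS[/Ck_on0 g0 gS] := gA.
apply/Ck_onS; split=> [|i].
  apply/Ck_on0 => x Ax; have [[cf df] [cg dg]] := (f0 x Ax, g0 x Ax).
  by split=> [|i]; [exact: (cvgD cf cg)|exact: (derivableD (df i) (dg i))].
apply: Ck_on_eq (IH _ _ (fS i) (gS i)) => // x Ax.
have [[_ df] [_ dg]] := (f0 x Ax, g0 x Ax).
exact/esym/(deriveD (df i) (dg i)).
Qed.

Lemma Ck_on_sum m A k (f : 'I_k -> 'rV[R]_n -> R) : open A ->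
  (forall i, Ck_on m A (f i)) -> Ck_on m A (fun x => \sum_i f i x).
Proof.
move=> oA fA; elim: k f fA => [|k IH] f fA.
  apply: (@Ck_on_eq m A (cst 0)) => // [x _|]; first by rewrite big_ord0.
  exact: ((Cinfty_onE _ _).1 (@Cinfty_on_cst A 0) m).
apply: (@Ck_on_eq m A (fun x => f ord0 x + \sum_i f (lift ord0 i) x) _ oA) => [x _|].
  by rewrite big_ord_recl.
by apply: Ck_onD => //; exact: IH.
Qed.

Lemma Ck_onM m A f g : open A -> Ck_on m A f -> Ck_on m A g ->
  Ck_on m A (fun x => f x * g x).
Proof.
move=> oA; elim: m f g => [|m IH] f g.
  move=> /Ck_on0 fA /Ck_on0 gA; apply/Ck_on0 => x Ax.
  have [[cf df] [cg dg]] := (fA x Ax, gA x Ax).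
  by split=> [|i]; [exact: (cvgM cf cg)|exact: (derivableM (df i) (dg i))].
move=> fA gA; have /Ck_onS[/Ck_on0 f0 fS] := fA; have /Ck_onS[/Ck_on0 g0 gS] := gA.
have fm := Ck_on_le (leqnSn m) fA; have gm := Ck_on_le (leqnSn m) gA.
apply/Ck_onS; split=> [|i].
  apply/Ck_on0 => x Ax; have [[cf df] [cg dg]] := (f0 x Ax, g0 x Ax).
  by split=> [|i]; [exact: (cvgM cf cg)|exact: (derivableM (df i) (dg i))].
apply: (@Ck_on_eq m A (fun x => f x * 'pd_i g x + g x * 'pd_i f x) _ oA) => [x Ax|]; last first.
  apply: (Ck_onD oA); first exact: (IH _ _ fm (gS i)).
  exact: (IH _ _ gm (fS i)).
have [[_ df] [_ dg]] := (f0 x Ax, g0 x Ax).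
exact/esym/(deriveM (df i) (dg i)).
Qed.

Lemma Cinfty_onD A f g : open A -> Cinfty_on A f -> Cinfty_on A g ->
  Cinfty_on A (fun x => f x + g x).
Proof.
move=> oA /Cinfty_onE fA /Cinfty_onE gA; apply/Cinfty_onE => m; exact: Ck_onD.
Qed.

Lemma Cinfty_onM A f g : open A -> Cinfty_on A f -> Cinfty_on A g ->
  Cinfty_on A (fun x => f x * g x).
Proof.
move=> oA /Cinfty_onE fA /Cinfty_onE gA; apply/Cinfty_onE => m; exact: Ck_onM.
Qed.

Lemma Cinfty_on_sum A k (f : 'I_k -> 'rV[R]_n -> R) : open A ->
  (forall i, Cinfty_on A (f i)) -> Cinfty_on A (fun x => \sum_i f i x).
Proof.
move=> oA fA; apply/Cinfty_onE => m; apply: Ck_on_sum => // i.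
exact: (Cinfty_onE _ _).1.
Qed.

(** Induction on the order, for all [h] at once: by the chain rule a partial derivative of [h \o T]
    is a sum of products of ['pd_k h \o T], covered by the induction, with partial derivatives of
    the components of [T]. *)
Lemma Cinfty_on_comp A B (h : 'rV[R]_n -> R) (T : 'rV[R]_n -> 'rV[R]_n) :
  open A -> open B -> (forall x, A x -> B (T x)) ->
  (forall k, Cinfty_on A (fun x => T x 0 k)) -> Cinfty_on B h ->
  Cinfty_on A (h \o T).
Proof.
move=> oA oB AB TA hB; apply/Cinfty_onE => m.
have dT x : A x -> differentiable T x.
  by move=> Ax; apply: differentiable_rV => k; exact: Cinfty_on_differentiable Ax.
have hT0 h' : Cinfty_on B h' -> Ck_on 0 A (h' \o T).
  move=> h'B; apply/Ck_on0 => x Ax.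
  have d : differentiable (h' \o T) x.
    apply: differentiable_comp; first exact: dT.
    by apply: Cinfty_on_differentiable h'B (AB _ Ax).
  by split=> [|i]; [exact: differentiable_continuous|exact: diff_derivable].
elim: m h hB => [|m IH] h hB; first exact: hT0.
apply/Ck_onS; split=> [|i]; first exact: hT0.
pose F k x := ('pd_k h \o T) x * 'pd_i (fun y => T y 0 k) x.
have FA k : Ck_on m A (F k).
  apply: (Ck_onM oA); first exact: IH (Cinfty_on_partial k hB).
  exact: (Cinfty_onE _ _).1 (Cinfty_on_partial i (TA k)) m.
apply: (@Ck_on_eq m A (fun x => \sum_k F k x) _ oA) => [x Ax|]; last exact: Ck_on_sum.
have dh : differentiable h (T x) by apply: Cinfty_on_differentiable hB (AB _ Ax).
rewrite derive_comp //; last exact: dT.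
rewrite [RHS]derive_sum_partials //; apply: eq_bigr => k _.
by rewrite derive_coord; [exact: mulrC|exact: dT].
Qed.

End FiniteSmoothness.

(** * Derivations and vector fields on a manifold *)

Section ManifoldCalculus.
Context {R : realType} {n : nat} {M : manifold R n}.
Implicit Types (U : set M) (X Y Z : M -> 'rV[R]_n) (f g : M -> R) (c d : chart M).

Lemma dom_chart_at (p : M) : dom (chart_at p) p.
Proof. exact: chart_atP. Qed.

(** The manifold axioms give this for the whole domain; continuity of [psi c] cuts it down to
    [U]. *)
Lemma open_chart_image c U : open U -> open (phi c @` (U `&` dom c)).
Proof.
move=> oU; rewrite openE => _ [p [Up cp] <-].
have ny : nbhs (phi c p) (phi c @` dom c).
  by apply: open_nbhs_nbhs; split; [exact: codom_open|exists p].
have nU : nbhs (phi c p) (psi c @^-1` U).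
  have /psi_continuous : phi c p \in phi c @` dom c by apply/mem_set; exists p.
  by apply; rewrite phiK //; exact: open_nbhs_nbhs.
near=> y; have [q cq qy] : (phi c @` dom c) y by near: y.
have Uq : (psi c @^-1` U) y by near: y.
by exists q => //; split=> //; move: Uq; rewrite /preimage /= -qy phiK.
Unshelve. all: by end_near. Qed.

Lemma near_chart c U p : open U -> U p -> dom c p ->
  \forall y \near phi c p, U (psi c y) /\ phi c (psi c y) = y.
Proof.
move=> oU Up cp; have : nbhs (phi c p) (phi c @` (U `&` dom c)).
  by apply: open_nbhs_nbhs; split; [exact: open_chart_image|exists p].
by apply: filterS => _ [q [Uq cq] <-]; rewrite phiK.
Qed.

Lemma transition_differentiable c d p : dom c p -> dom d p ->
  differentiable (phi d \o psi c) (phi c p).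
Proof.
move=> cp dp; apply: differentiable_rV => k.
apply: (Cinfty_on_differentiable _ (@transition_smooth _ _ _ c d k)); last by exists p.
by rewrite setIC; apply: open_chart_image; exact: dom_open.
Qed.

(** Chart independence of the derivation: [along X (phi c) p] is the coordinate vector of [X p] in
    [c], and the chain rule passes through the transition from [chart_at p] to [c]. *)
Lemma along_chart (V : normedModType R) c X (f : M -> V) p : dom c p ->
  differentiable (f \o psi c) (phi c p) ->
  along X f p = 'D_(along X (phi c) p) (f \o psi c) (phi c p).
Proof.
move=> cp df; pose c' := chart_at p; have c'p : dom c' p := dom_chart_at p.
have dt := transition_differentiable (dom_chart_at p) cp.
have E : (phi c \o psi c') (phi c' p) = phi c p by rewrite /= phiK.
have df' : differentiable (f \o psi c) ((phi c \o psi c') (phi c' p)) by rewrite E.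
have := derive_comp (X p) dt df'; rewrite E => <-.
apply: near_eq_derive.
apply: filterS (near_chart (@dom_open _ _ _ c) cp (dom_chart_at p)) => y [cy _].
by rewrite /= phiK.
Qed.

Lemma along_phi_chart_at X p : along X (phi (chart_at p)) p = X p.
Proof.
rewrite /along (@near_eq_derive _ _ _ _ id) ?derive_id //.
by apply: filterS (near_chart openT I (dom_chart_at p)) => y [].
Qed.

Lemma along_eq (V : normedModType R) U X Y (f g : M -> V) p : open U -> U p ->
  X p = Y p -> (forall q, U q -> f q = g q) -> along X f p = along Y g p.
Proof.
move=> oU Up XY fg; rewrite /along XY; apply: near_eq_derive.
apply: filterS (near_chart oU Up (dom_chart_at p)) => y [Uy _]; exact: fg.
Qed.

Lemma smooth_on_sub U U' f : U' `<=` U -> smooth_on U f -> smooth_on U' f.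
Proof.
move=> UU' fU c; apply: Cinfty_on_sub (fU c).
by apply: image_subset => q [/UU' ? ?].
Qed.

Lemma vfield_on_sub U U' X : U' `<=` U -> vfield_on U X -> vfield_on U' X.
Proof.
move=> UU' XU c k; apply: Cinfty_on_sub (XU c k).
by apply: image_subset => q [/UU' ? ?].
Qed.

Lemma smooth_on_eq U f g : open U -> (forall p, U p -> f p = g p) ->
  smooth_on U f -> smooth_on U g.
Proof.
move=> oU fg fU c; apply: Cinfty_on_eq (fU c); first exact: open_chart_image.
by move=> _ [q [Uq cq] <-]; rewrite /= (phiK cq); exact: fg.
Qed.

Lemma vfield_on_eq U X Y : open U -> (forall p, U p -> X p = Y p) ->
  vfield_on U X -> vfield_on U Y.
Proof.
move=> oU XY XU c k; apply: Cinfty_on_eq (XU c k); first exact: open_chart_image.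
move=> _ [q [Uq cq] <-]; rewrite /= (phiK cq).
by rewrite (along_eq oU Uq (XY _ Uq) (fun _ _ => erefl)).
Qed.

Lemma smooth_on_cst U (a : R) : smooth_on U (fun=> a).
Proof. by move=> c; exact: Cinfty_on_cst. Qed.

Lemma smooth_onM U f g : open U -> smooth_on U f -> smooth_on U g ->
  smooth_on U (fun p => f p * g p).
Proof.
move=> oU fU gU c; apply: Cinfty_onM (fU c) (gU c); exact: open_chart_image.
Qed.

Lemma smooth_onN U f : open U -> smooth_on U f -> smooth_on U (fun p => - f p).
Proof.
move=> oU fU; apply: (@smooth_on_eq U (fun p => -1 * f p) _ oU) => [p _|].
  by rewrite mulN1r.
exact: (smooth_onM oU (@smooth_on_cst U (-1)) fU).
Qed.

Lemma smooth_on_differentiable U f c p : open U -> smooth_on U f -> U p ->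
  dom c p -> differentiable (f \o psi c) (phi c p).
Proof.
move=> oU fU Up cp; apply: (Cinfty_on_differentiable _ (fU c)); last by exists p.
exact: open_chart_image.
Qed.

Lemma along_linear (V : normedModType R) (f : M -> V) p (a : R) X Y Z :
  differentiable (f \o psi (chart_at p)) (phi (chart_at p) p) ->
  Z p = a *: X p + Y p -> along Z f p = a *: along X f p + along Y f p.
Proof. by move=> df Zp; rewrite /along Zp derive_linear. Qed.

Lemma along_phi_linear c p (a : R) X Y Z : dom c p ->
  Z p = a *: X p + Y p ->
  along Z (phi c) p = a *: along X (phi c) p + along Y (phi c) p.
Proof. by move=> cp; apply: along_linear; exact: (transition_differentiable (dom_chart_at p) cp). Qed.

Lemma vfield_on_linear U f X Y : open U -> smooth_on U f -> vfield_on U X ->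
  vfield_on U Y -> vfield_on U (fun p => f p *: X p + Y p).
Proof.
move=> oU fU XU YU c k; have oA := open_chart_image (c := c) oU.
apply: Cinfty_on_eq (Cinfty_onD oA (Cinfty_onM oA (fU c) (XU c k)) (YU c k)) => //.
move=> _ [q [Uq cq] <-]; rewrite /= (phiK cq).
by rewrite (@along_phi_linear c q (f q) X Y _ cq erefl) !mxE.
Qed.

Lemma vfield_on0 U : open U -> vfield_on U (fun=> 0).
Proof.
move=> oU c k; apply: Cinfty_on_eq (@Cinfty_on_cst _ _ _ 0).
  exact: open_chart_image.
by move=> _ [q [Uq cq] <-]; rewrite /along derive0 mxE.
Qed.

Lemma vfield_onZ U f X : open U -> smooth_on U f -> vfield_on U X ->
  vfield_on U (fun p => f p *: X p).
Proof.
move=> oU fU XU; apply: (@vfield_on_eq U (fun p => f p *: X p + 0) _ oU) => [p _|].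
  by rewrite addr0.
exact: (vfield_on_linear oU fU XU (vfield_on0 oU)).
Qed.

Lemma vfield_onB U X Y : open U -> vfield_on U X -> vfield_on U Y ->
  vfield_on U (fun p => X p - Y p).
Proof.
move=> oU XU YU; apply: (@vfield_on_eq U (fun p => -1 *: Y p + X p) _ oU) => [p _|].
  by rewrite scaleN1r addrC.
exact: (vfield_on_linear oU (@smooth_on_cst U (-1)) YU XU).
Qed.

(** With [c] kept fixed while [p] varies, the right-hand side can be differentiated again, unlike
    the definition of [along], whose chart depends on the point. *)
Lemma along_partials U f X c p : open U -> smooth_on U f -> U p -> dom c p ->
  along X f p = \sum_k along X (phi c) p 0 k * 'D_(delta_mx 0 k) (f \o psi c) (phi c p).
Proof.
move=> oU fU Up cp; have df := smooth_on_differentiable oU fU Up cp.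
by rewrite (along_chart X cp df) derive_sum_partials.
Qed.

Lemma smooth_on_along U X f : open U -> vfield_on U X -> smooth_on U f ->
  smooth_on U (along X f).
Proof.
move=> oU XU fU c; have oA := open_chart_image (c := c) oU.
apply: (@Cinfty_on_eq _ _ _ (fun y => \sum_k along X (phi c) (psi c y) 0 k *
    'D_(delta_mx 0 k) (f \o psi c) y)) => // [_ [q [Uq cq] <-]|].
  by rewrite /= phiK //; apply/esym/(along_partials _ oU).
apply: (Cinfty_on_sum oA) => k; apply: (Cinfty_onM oA (XU c k)).
exact: (Cinfty_on_partial k (fU c)).
Qed.

Lemma alongD U X f g p : open U -> smooth_on U f -> smooth_on U g -> U p ->
  along X (fun q => f q + g q) p = along X f p + along X g p.
Proof.
move=> oU fU gU Up; rewrite /along -deriveD //; apply: diff_derivable.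
  exact: (smooth_on_differentiable oU fU Up (dom_chart_at p)).
exact: (smooth_on_differentiable oU gU Up (dom_chart_at p)).
Qed.

(** Product rule for [Y f = sum_k Y^k d_k f]. The terms with [X(Y^k)] are collected into one
    directional derivative, along the very vector that enters [bracket]; the rest is the Hessian of
    [f] in the chart. *)
Lemma along_along U X Y f p : open U -> vfield_on U X -> vfield_on U Y ->
  smooth_on U f -> U p -> let c := chart_at p in
  along X (along Y f) p =
    'D_(along X (along Y (phi c)) p) (f \o psi c) (phi c p) +
    \sum_k \sum_j Y p 0 k * (X p 0 j *
      'D_(delta_mx 0 j) ('D_(delta_mx 0 k) (f \o psi c)) (phi c p)).
Proof.
move=> oU XU YU fU Up c; have oA := open_chart_image (c := c) oU.
have Ap : (phi c @` (U `&` dom c)) (phi c p) by exists p; split=> //; exact: dom_chart_at.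
pose F := f \o psi c; pose b k y := along Y (phi c) (psi c y) 0 k.
have db k : differentiable (b k) (phi c p) by apply: Cinfty_on_differentiable (YU c k) Ap.
have dF k : differentiable ('D_(delta_mx 0 k) F) (phi c p).
  exact: Cinfty_on_differentiable (Cinfty_on_partial k (fU c)) Ap.
have -> : along X (along Y f) p =
    'D_(X p) (\sum_k (b k * 'D_(delta_mx 0 k) F)) (phi c p).
  apply: near_eq_derive; near=> y.
  have [q [Uq cq] <-] : (phi c @` (U `&` dom c)) y by near: y; exact: open_nbhs_nbhs.
  rewrite /= (phiK cq) fct_sumE (along_partials _ oU fU Uq cq).
  have bq k : b k (phi c q) = along Y (phi c) q 0 k by rewrite /b (phiK cq).
  by apply: eq_bigr => k _; rewrite -bq.
rewrite derive_sum => [|k]; last by apply: derivableM; exact: diff_derivable.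
rewrite [X in X + _]derive_sum_partials; last first.
  exact: Cinfty_on_differentiable (fU c) Ap.
rewrite -big_split; apply: eq_bigr => k _ /=.
rewrite deriveM; try exact: diff_derivable.
rewrite [LHS]addrC; apply: f_equal2.
  rewrite [LHS]mulrC; congr (_ * _).
  rewrite /along derive_coord //.
  by apply: differentiable_rV => l; exact: db.
rewrite /b phiK; last exact: dom_chart_at.
rewrite along_phi_chart_at -mulr_sumr; congr (_ * _).
by rewrite derive_sum_partials.
Unshelve. all: by end_near. Qed.

Lemma along_bracket U X Y f p : open U -> vfield_on U X -> vfield_on U Y ->
  smooth_on U f -> U p ->
  along (bracket X Y) f p = along X (along Y f) p - along Y (along X f) p.
Proof.
move=> oU XU YU fU Up; pose c := chart_at p; pose F := f \o psi c.
have Ap : (phi c @` (U `&` dom c)) (phi c p) by exists p; split=> //; exact: dom_chart_at.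
(* [s] and [t] are the Hessian terms, equal because partials commute; [a - b] is the derivative
   along the bracket. *)
have cancel (a b s t e : R) : s = t -> e = a - b -> e = a + s - (b + t).
  by move=> -> ->; ring.
rewrite (along_along oU XU YU fU Up) (along_along oU YU XU fU Up).
apply: cancel; last first.
  exact: (derive_subv _ _ (smooth_on_differentiable oU fU Up (dom_chart_at p))).
rewrite exchange_big; apply: eq_bigr => k _; apply: eq_bigr => j _.
rewrite (Cinfty_on_partialC k j (open_chart_image (c := c) oU) (fU c) Ap).
exact: mulrCA.
Qed.

Lemma coord_field_chart c d i p : dom c p -> dom d p ->
  along (coord_field c i) (phi d) p = 'D_(delta_mx 0 i) (phi d \o psi c) (phi c p).
Proof.
move=> cp dp; pose c' := chart_at p; have c'p : dom c' p := dom_chart_at p.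
have E : (phi c' \o psi c) (phi c p) = phi c' p by rewrite /= phiK.
have dd : differentiable (phi d \o psi c') ((phi c' \o psi c) (phi c p)).
  by rewrite E; exact: (transition_differentiable (dom_chart_at p) dp).
have := derive_comp (delta_mx 0 i) (transition_differentiable cp (dom_chart_at p)) dd.
rewrite E => C; apply: etrans (esym C) _; apply: near_eq_derive.
apply: filterS (near_chart (@dom_open _ _ _ c') (dom_chart_at p) cp) => y [cy _].
by rewrite /= phiK.
Qed.

Lemma coord_field_chart_at (p : M) i : coord_field (chart_at p) i p = delta_mx 0 i.
Proof.
rewrite /coord_field (@near_eq_derive _ _ _ _ id) ?derive_id //.
by apply: filterS (near_chart openT I (dom_chart_at p)) => y [].
Qed.

(** Read in another chart [d], a component is a partial derivative of the transition from [c] to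
    [d], composed with the transition from [d] to [c]. *)
Lemma vfield_on_coord_field c i : vfield_on (dom c) (coord_field c i).
Proof.
move=> d k; pose A := phi d @` (dom c `&` dom d); pose B := phi c @` (dom c `&` dom d).
have oA : open A by apply: open_chart_image; exact: dom_open.
have oB : open B by rewrite /B setIC; apply: open_chart_image; exact: dom_open.
apply: (@Cinfty_on_eq _ _ _
   ('D_(delta_mx 0 i) (fun x => phi d (psi c x) 0 k) \o (phi c \o psi d))) => //.
  move=> _ [q [cq dq] <-]; rewrite /= phiK // coord_field_chart //.
  by rewrite derive_coord //; exact: transition_differentiable.
apply: (Cinfty_on_comp oA oB).
- by move=> _ [q [cq dq] <-] /=; rewrite phiK //; exists q.
- by move=> l; rewrite /A setIC; exact: transition_smooth.
- exact/Cinfty_on_partial/transition_smooth.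
Qed.

End ManifoldCalculus.

(** * Torsion-free connections *)

(** [a - b - c] is the shape of [curvature]: its three terms are expanded separately and put
    together here. *)
Lemma congr_sub2 (V : zmodType) (a b c a' b' c' : V) :
  a = a' -> b = b' -> c = c' -> a - b - c = a' - b' - c'.
Proof. by move=> -> -> ->. Qed.

Lemma coord_linear (R : ringType) m (r : R) (u v : 'rV[R]_m) i :
  (r *: u + v) 0 i = r * u 0 i + v 0 i.
Proof. by rewrite !mxE. Qed.

Section TorsionFreeConnection.
Context {R : realType} {n : nat} {M : manifold R n}.
Local Notation vf := (M -> 'rV[R]_n).
Context {D : vf -> vf -> vf} (connD : affine_connection D).
Implicit Types (U : set M) (X Y Z A B : vf) (f h : M -> R).

Lemma conn_eq U X X' Y Y' p : open U -> vfield_on U X -> vfield_on U Y ->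
  (forall q, U q -> X q = X' q) -> (forall q, U q -> Y q = Y' q) -> U p ->
  D X Y p = D X' Y' p.
Proof.
move=> oU XU YU XX' YY' Up; apply: (conn_local connD oU XU YU); last exact: mem_set.
- by move=> q /set_mem; exact: XX'.
- by move=> q /set_mem; exact: YY'.
Qed.

Lemma conn_linearl U f X X' Y p : open U -> smooth_on U f -> vfield_on U X ->
  vfield_on U X' -> vfield_on U Y -> U p ->
  D (fun q => f q *: X q + X' q) Y p = f p *: D X Y p + D X' Y p.
Proof.
move=> oU fU XU X'U YU /mem_set Up.
by rewrite (conn_addl connD oU (vfield_onZ oU fU XU) X'U YU Up)
  (conn_scalel connD oU fU XU YU Up).
Qed.

Lemma conn_linearr U f X Y Y' p : open U -> smooth_on U f -> vfield_on U X ->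
  vfield_on U Y -> vfield_on U Y' -> U p ->
  D X (fun q => f q *: Y q + Y' q) p =
    along X f p *: Y p + f p *: D X Y p + D X Y' p.
Proof.
move=> oU fU XU YU Y'U /mem_set Up.
by rewrite (conn_addr connD oU XU (vfield_onZ oU fU YU) Y'U Up)
  (conn_leibniz connD oU fU XU YU Up).
Qed.

(** The differentiated field has the shape of the semi-symmetric metric connection: a derivative,
    plus [pi(Z)] times a field, minus an inner product times [P]. *)
Lemma conn_comb U f h X A Y B p : open U -> smooth_on U f -> smooth_on U h ->
  vfield_on U X -> vfield_on U A -> vfield_on U Y -> vfield_on U B -> U p ->
  D X (fun q => A q + f q *: Y q - h q *: B q) p =
    D X A p + (along X f p *: Y p + f p *: D X Y p)
    - (along X h p *: B p + h p *: D X B p).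
Proof.
move=> oU fU hU XU AU YU BU Up.
have fYA := vfield_on_linear oU fU YU AU; have hB := vfield_onZ oU hU BU.
have := conn_linearr oU (@smooth_on_cst _ _ _ U (-1)) XU hB fYA Up.
rewrite (conn_linearr oU fU XU YU AU Up) (conn_leibniz connD oU hU XU BU (mem_set Up)).
rewrite {1}/along derive_cst scale0r add0r scaleN1r => E.
transitivity (D X (fun q => -1 *: (h q *: B q) + (f q *: Y q + A q)) p).
  by congr (D X _ p); apply/funext => q; rewrite scaleN1r addrC [A q + _]addrC.
by rewrite E; apply/rowP => k; rewrite !mxE; ring.
Qed.

Lemma conn0r U X p : open U -> vfield_on U X -> U p -> D X (fun=> 0) p = 0.
Proof.
move=> oU XU Up; have V0 := @vfield_on0 _ _ M U oU.
have := conn_leibniz connD oU (@smooth_on_cst _ _ _ U 0) XU V0 (mem_set Up).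
by rewrite /= !(scale0r, scaler0, addr0).
Qed.

Context (torsion_free : forall U X Y, open U -> vfield_on U X -> vfield_on U Y ->
  {in U, (fun p => D X Y p - D Y X p) =1 bracket X Y}).

Lemma bracketE U X Y p : open U -> vfield_on U X -> vfield_on U Y -> U p ->
  bracket X Y p = D X Y p - D Y X p.
Proof. by move=> oU XU YU /mem_set Up; rewrite -(torsion_free oU XU YU Up). Qed.

Lemma vfield_on_bracket U X Y : open U -> vfield_on U X -> vfield_on U Y ->
  vfield_on U (bracket X Y).
Proof.
move=> oU XU YU; apply: (@vfield_on_eq _ _ _ U (fun p => D X Y p - D Y X p) _ oU).
  by move=> p Up; rewrite (bracketE oU XU YU Up).
exact: (vfield_onB oU (conn_smooth connD oU XU YU) (conn_smooth connD oU YU XU)).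
Qed.

Lemma bracket_linearr U f X Y Y' p : open U -> smooth_on U f -> vfield_on U X ->
  vfield_on U Y -> vfield_on U Y' -> U p ->
  bracket X (fun q => f q *: Y q + Y' q) p =
    along X f p *: Y p + (f p *: bracket X Y p + bracket X Y' p).
Proof.
move=> oU fU XU YU Y'U Up; have fY := vfield_on_linear oU fU YU Y'U.
rewrite (bracketE oU XU fY Up) (bracketE oU XU YU Up) (bracketE oU XU Y'U Up).
rewrite (conn_linearr oU fU XU YU Y'U Up) (conn_linearl oU fU YU Y'U XU Up).
by apply/rowP => k; rewrite !mxE; ring.
Qed.

Lemma vfield_on_curvature U X Y Z : open U -> vfield_on U X -> vfield_on U Y ->
  vfield_on U Z -> vfield_on U (curvature D X Y Z).
Proof.
move=> oU XU YU ZU; have BU := vfield_on_bracket oU XU YU.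
have smoothD A B : vfield_on U A -> vfield_on U B -> vfield_on U (D A B).
  exact: (conn_smooth connD oU).
apply: (vfield_onB oU _ (smoothD _ _ BU ZU)).
exact: (vfield_onB oU (smoothD _ _ XU (smoothD _ _ YU ZU))
  (smoothD _ _ YU (smoothD _ _ XU ZU))).
Qed.

Lemma curvature_eq U X Y Y' Z Z' p : open U -> vfield_on U X -> vfield_on U Y ->
  vfield_on U Z -> (forall q, U q -> Y q = Y' q) -> (forall q, U q -> Z q = Z' q) ->
  U p -> curvature D X Y Z p = curvature D X Y' Z' p.
Proof.
move=> oU XU YU ZU YY' ZZ' Up.
have Y'U := vfield_on_eq oU YY' YU.
have BU := vfield_on_bracket oU XU YU.
have DYZ := conn_smooth connD oU YU ZU; have DXZ := conn_smooth connD oU XU ZU.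
have BE q : U q -> bracket X Y q = bracket X Y' q.
  move=> Uq; rewrite (bracketE oU XU YU Uq) (bracketE oU XU Y'U Uq).
  by rewrite (conn_eq oU XU YU (fun _ _ => erefl) YY' Uq)
    (conn_eq oU YU XU YY' (fun _ _ => erefl) Uq).
rewrite /curvature; apply: congr_sub2.
- by apply: (conn_eq oU XU DYZ _ _ Up) => // q; exact: (conn_eq oU YU ZU YY' ZZ').
- by apply: (conn_eq oU YU DXZ YY' _ Up) => q; exact: (conn_eq oU XU ZU _ ZZ').
- exact: (conn_eq oU BU ZU BE ZZ' Up).
Qed.

(** The Leibniz term [(X f) D_Y Z] occurs twice, from [D_X (D_Y Z)] and from the bracket, and
    cancels. *)
Lemma curvature_linear2 U f X Y Y' Z p : open U -> smooth_on U f ->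
  vfield_on U X -> vfield_on U Y -> vfield_on U Y' -> vfield_on U Z -> U p ->
  curvature D X (fun q => f q *: Y q + Y' q) Z p =
    f p *: curvature D X Y Z p + curvature D X Y' Z p.
Proof.
move=> oU fU XU YU Y'U ZU Up; rewrite /curvature.
have smoothD A B : vfield_on U A -> vfield_on U B -> vfield_on U (D A B).
  exact: (conn_smooth connD oU).
have BY := vfield_on_bracket oU XU YU; have BY' := vfield_on_bracket oU XU Y'U.
have fY := vfield_on_linear oU fU YU Y'U.
have XfU := smooth_on_along oU XU fU.
have E1 : D X (D (fun q => f q *: Y q + Y' q) Z) p =
    along X f p *: D Y Z p + f p *: D X (D Y Z) p + D X (D Y' Z) p.
  apply: etrans (conn_linearr oU fU XU (smoothD _ _ YU ZU) (smoothD _ _ Y'U ZU) Up).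
  apply: (conn_eq oU XU (smoothD _ _ fY ZU) _ _ Up) => // q Uq.
  exact: (conn_linearl oU fU YU Y'U ZU Uq).
have E2 := conn_linearl oU fU YU Y'U (smoothD _ _ XU ZU) Up.
have E3 : D (bracket X (fun q => f q *: Y q + Y' q)) Z p =
    along X f p *: D Y Z p + (f p *: D (bracket X Y) Z p + D (bracket X Y') Z p).
  rewrite -(conn_linearl oU fU BY BY' ZU Up).
  apply: etrans (conn_linearl oU XfU YU (vfield_on_linear oU fU BY BY') ZU Up).
  apply: (conn_eq oU (vfield_on_bracket oU XU fY) ZU _ _ Up) => // q Uq.
  exact: (bracket_linearr oU fU XU YU Y'U Uq).
have alg (r s : R) (u a b c a' b' c' : 'rV[R]_n) :
    s *: u + r *: a + a' - (r *: b + b') - (s *: u + (r *: c + c'))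
    = r *: (a - b - c) + (a' - b' - c').
  by apply/rowP => k; rewrite !mxE; ring.
exact: etrans (congr_sub2 E1 E2 E3) (alg _ _ _ _ _ _ _ _ _).
Qed.

(** First-order terms in [f] cancel between the two iterated derivatives; the second-order ones
    leave [X(Yf) - Y(Xf)], which the bracket term removes by [along_bracket]. *)
Lemma curvature_linear3 U f X Y Z Z' p : open U -> smooth_on U f ->
  vfield_on U X -> vfield_on U Y -> vfield_on U Z -> vfield_on U Z' -> U p ->
  curvature D X Y (fun q => f q *: Z q + Z' q) p =
    f p *: curvature D X Y Z p + curvature D X Y Z' p.
Proof.
move=> oU fU XU YU ZU Z'U Up; rewrite /curvature.
have smoothD A B : vfield_on U A -> vfield_on U B -> vfield_on U (D A B).
  exact: (conn_smooth connD oU).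
have DD A B : vfield_on U A -> vfield_on U B ->
    D A (D B (fun q => f q *: Z q + Z' q)) p =
      along A (along B f) p *: Z p + along B f p *: D A Z p
      + (along A f p *: D B Z p + f p *: D A (D B Z) p + D A (D B Z') p).
  move=> AU BU; have BfU := smooth_on_along oU BU fU.
  have [BZ BZ'] := (smoothD _ _ BU ZU, smoothD _ _ BU Z'U).
  rewrite -(conn_linearr oU fU AU BZ BZ' Up).
  apply: etrans (conn_linearr oU BfU AU ZU (vfield_on_linear oU fU BZ BZ') Up).
  apply: (conn_eq oU AU (smoothD _ _ BU (vfield_on_linear oU fU ZU Z'U)) _ _ Up) => // q Uq.
  by rewrite (conn_linearr oU fU BU ZU Z'U Uq) addrA.
have E3 := conn_linearr oU fU (vfield_on_bracket oU XU YU) ZU Z'U Up.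
rewrite (along_bracket oU XU YU fU Up) in E3.
have alg (r s t s' t' : R) (z xz yz a b c a' b' c' : 'rV[R]_n) :
    s *: z + t *: xz + (t' *: yz + r *: a + a')
    - (s' *: z + t' *: yz + (t *: xz + r *: b + b'))
    - ((s - s') *: z + r *: c + c') = r *: (a - b - c) + (a' - b' - c').
  by apply/rowP => k; rewrite !mxE; ring.
apply: etrans (congr_sub2 (DD _ _ XU YU) (DD _ _ YU XU) E3) _.
exact: alg.
Qed.

(** The trace at [p] uses coordinate fields that are smooth only on a chart domain, so the curvature
    laws are applied on the intersection of [U] with it. *)
Let coord_on U (p : M) i : open U ->
  vfield_on (U `&` dom (chart_at p)) (coord_field (chart_at p) i).
Proof. 
move=> oU; apply: (@vfield_on_sub _ _ _ (dom (chart_at p))); first by move=> q [].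
exact: vfield_on_coord_field.
 Qed.

Let coord_open U (p : M) : open U -> open (U `&` dom (chart_at p)).
Proof. by move=> oU; apply: openI => //; exact: dom_open. Qed.

Lemma ricciE (D' : vf -> vf -> vf) Y Z p :
  ricci D' Y Z p = \sum_i curvature D' (coord_field (chart_at p) i) Y Z p 0 i.
Proof. by apply: eq_bigr => i _; rewrite mxE. Qed.

Lemma ricci_eq U Y Y' Z Z' p : open U -> vfield_on U Y -> vfield_on U Z ->
  (forall q, U q -> Y q = Y' q) -> (forall q, U q -> Z q = Z' q) -> U p ->
  ricci D Y Z p = ricci D Y' Z' p.
Proof.
move=> oU YU ZU YY' ZZ' Up; rewrite !ricciE; apply: eq_bigr => i _.
have sub : U `&` dom (chart_at p) `<=` U by move=> q [].
have Up' : (U `&` dom (chart_at p)) p by split=> //; exact: dom_chart_at.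
have E := curvature_eq (coord_open p oU) (coord_on i oU) (vfield_on_sub sub YU)
  (vfield_on_sub sub ZU) (fun q Uq => YY' q (sub q Uq)) (fun q Uq => ZZ' q (sub q Uq)) Up'.
exact: (congr1 (fun v : 'rV[R]_n => v 0 i) E).
Qed.

Lemma ricci_linearl U f Y Y' Z p : open U -> smooth_on U f ->
  vfield_on U Y -> vfield_on U Y' -> vfield_on U Z -> U p ->
  ricci D (fun q => f q *: Y q + Y' q) Z p = f p * ricci D Y Z p + ricci D Y' Z p.
Proof.
move=> oU fU YU Y'U ZU Up; rewrite !ricciE mulr_sumr -big_split; apply: eq_bigr => i _ /=.
have sub : U `&` dom (chart_at p) `<=` U by move=> q [].
have Up' : (U `&` dom (chart_at p)) p by split=> //; exact: dom_chart_at.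
have E := curvature_linear2 (coord_open p oU) (smooth_on_sub sub fU) (coord_on i oU)
  (vfield_on_sub sub YU) (vfield_on_sub sub Y'U) (vfield_on_sub sub ZU) Up'.
exact: etrans (congr1 (fun v : 'rV[R]_n => v 0 i) E) (coord_linear _ _ _ _).
Qed.

Lemma ricci_linearr U f Y Z Z' p : open U -> smooth_on U f ->
  vfield_on U Y -> vfield_on U Z -> vfield_on U Z' -> U p ->
  ricci D Y (fun q => f q *: Z q + Z' q) p = f p * ricci D Y Z p + ricci D Y Z' p.
Proof.
move=> oU fU YU ZU Z'U Up; rewrite !ricciE mulr_sumr -big_split; apply: eq_bigr => i _ /=.
have sub : U `&` dom (chart_at p) `<=` U by move=> q [].
have Up' : (U `&` dom (chart_at p)) p by split=> //; exact: dom_chart_at.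
have E := curvature_linear3 (coord_open p oU) (smooth_on_sub sub fU) (coord_on i oU)
  (vfield_on_sub sub YU) (vfield_on_sub sub ZU) (vfield_on_sub sub Z'U) Up'.
exact: etrans (congr1 (fun v : 'rV[R]_n => v 0 i) E) (coord_linear _ _ _ _).
Qed.

Lemma ricci0l U Z p : open U -> vfield_on U Z -> U p -> ricci D (fun=> 0) Z p = 0.
Proof.
move=> oU ZU Up; have V0 := @vfield_on0 _ _ M U oU.
(* Linearity at [1 *: 0 + 0] says that the value equals its double. *)
have := ricci_linearl oU (@smooth_on_cst _ _ _ U 1) V0 V0 ZU Up.
have -> : (fun q : M => 1 *: 0 + 0) = (fun=> 0 : 'rV[R]_n).
  by apply/funext => q; rewrite scaler0 addr0.
by move=> /eqP; rewrite mul1r -[X in X == _]addr0 (inj_eq (addrI _)) => /eqP.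
Qed.

Lemma ricci0r U Y p : open U -> vfield_on U Y -> U p -> ricci D Y (fun=> 0) p = 0.
Proof.
move=> oU YU Up; have V0 := @vfield_on0 _ _ M U oU.
have := ricci_linearr oU (@smooth_on_cst _ _ _ U 1) YU V0 V0 Up.
have -> : (fun q : M => 1 *: 0 + 0) = (fun=> 0 : 'rV[R]_n).
  by apply/funext => q; rewrite scaler0 addr0.
by move=> /eqP; rewrite mul1r -[X in X == _]addr0 (inj_eq (addrI _)) => /eqP.
Qed.

Let comb (r s x y x' e e0 : R) :
  e = r * x + y -> y = - s * x' + e0 -> e0 = 0 -> e = r * x - s * x'.
Proof. by move=> -> -> ->; ring. Qed.

Lemma ricci_combl U f h Y Y' Z p : open U -> smooth_on U f -> smooth_on U h ->
  vfield_on U Y -> vfield_on U Y' -> vfield_on U Z -> U p ->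
  ricci D (fun q => f q *: Y q - h q *: Y' q) Z p =
    f p * ricci D Y Z p - h p * ricci D Y' Z p.
Proof.
move=> oU fU hU YU Y'U ZU Up; have V0 := @vfield_on0 _ _ M U oU.
have hN := smooth_onN oU hU; have hY' := vfield_on_linear oU hN Y'U V0.
have -> : (fun q => f q *: Y q - h q *: Y' q)
    = (fun q => f q *: Y q + (- h q *: Y' q + 0)).
  by apply/funext => q; rewrite addr0 scaleNr.
exact: comb (ricci_linearl oU fU YU hY' ZU Up)
  (ricci_linearl oU hN Y'U V0 ZU Up) (ricci0l oU ZU Up).
Qed.

Lemma ricci_combr U f h Y Z Z' p : open U -> smooth_on U f -> smooth_on U h ->
  vfield_on U Y -> vfield_on U Z -> vfield_on U Z' -> U p ->
  ricci D Y (fun q => f q *: Z q - h q *: Z' q) p =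
    f p * ricci D Y Z p - h p * ricci D Y Z' p.
Proof.
move=> oU fU hU YU ZU Z'U Up; have V0 := @vfield_on0 _ _ M U oU.
have hN := smooth_onN oU hU; have hZ' := vfield_on_linear oU hN Z'U V0.
have -> : (fun q => f q *: Z q - h q *: Z' q)
    = (fun q => f q *: Z q + (- h q *: Z' q + 0)).
  by apply/funext => q; rewrite addr0 scaleNr.
exact: comb (ricci_linearr oU fU YU ZU hZ' Up)
  (ricci_linearr oU hN YU Z'U V0 Up) (ricci0r oU YU Up).
Qed.

End TorsionFreeConnection.

(** * The semi-symmetric metric connection *)

Section InnerProduct.
Context {R : realType} {n : nat} (G : 'M[R]_n).
Implicit Types u v w : 'rV[R]_n.

(** The inner product at a single point: tensor identities become identities in independent row
    vectors, within reach of [ring] and [lra]. *)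
Definition gform u v := (u *m G *m v^T) 0 0.

Lemma gformDl u v w : gform (u + v) w = gform u w + gform v w.
Proof. by rewrite /gform !mulmxDl mxE. Qed.

Lemma gformZl (a : R) u w : gform (a *: u) w = a * gform u w.
Proof. by rewrite /gform -!scalemxAl mxE. Qed.

Lemma gformNl u w : gform (- u) w = - gform u w.
Proof. by rewrite -scaleN1r gformZl mulN1r. Qed.

Lemma gform0l w : gform 0 w = 0.
Proof. by rewrite -(scale0r 0) gformZl mul0r. Qed.

Lemma gformDr u v w : gform u (v + w) = gform u v + gform u w.
Proof. by rewrite /gform linearD /= mulmxDr mxE. Qed.

Lemma gformZr (a : R) u w : gform u (a *: w) = a * gform u w.
Proof. by rewrite /gform linearZ /= -scalemxAr mxE. Qed.

Lemma gformNr u w : gform u (- w) = - gform u w.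
Proof. by rewrite -scaleN1r gformZr mulN1r. Qed.

Lemma gform0r u : gform u 0 = 0.
Proof. by rewrite -(scale0r 0) gformZr mul0r. Qed.

Lemma gformC u v : G^T = G -> gform u v = gform v u.
Proof.
move=> GT; rewrite /gform; have -> : v *m G *m u^T = (u *m G *m v^T)^T.
  by rewrite !trmx_mul trmxK GT mulmxA.
by rewrite [RHS]mxE.
Qed.

(** The left-hand side is the trace of the rank-one map [x |-> g(x,v) u], taken in a basis that may
    fail to be orthonormal. *)
Lemma gform_sum_delta u v : \sum_i gform (delta_mx 0 i) v * u 0 i = gform u v.
Proof.
rewrite [u in RHS]row_sum_delta /gform !mulmx_suml summxE.
by apply: eq_bigr => i _; rewrite -!scalemxAl [RHS]mxE mulrC.
Qed.

End InnerProduct.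

Section SemiSymmetricMetricConnection.
Context {R : realType} {n : nat} {M : manifold R n} (g : metric M).
Local Notation vf := (M -> 'rV[R]_n).
Context (nabla : vf -> vf -> vf) (lc : levi_civita g nabla).
Implicit Types (U : set M) (X Y Z W : vf) (p : M).

Let conn := lc_connection lc.
Let tf := lc_torsion_free lc.
Local Notation "<[ u , v ]>_ p" := (gform (gram g p) u v)
  (at level 10, p at level 2, format "<[ u ,  v ]>_ p").

Lemma innerE X Y p : inner g X Y p = <[X p, Y p]>_p.
Proof. by []. Qed.

Lemma smooth_on_inner U X Y : open U -> vfield_on U X -> vfield_on U Y ->
  smooth_on U (inner g X Y).
Proof. exact: gram_smooth. Qed.

Lemma along_inner U X Y Z p : open U -> vfield_on U X -> vfield_on U Y ->
  vfield_on U Z -> U p ->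
  along X (inner g Y Z) p = <[nabla X Y p, Z p]>_p + <[Y p, nabla X Z p]>_p.
Proof.
by move=> oU XU YU ZU /mem_set Up; exact: (lc_metric lc oU XU YU ZU Up).
Qed.

Let smoothD U X Y : open U -> vfield_on U X -> vfield_on U Y ->
  vfield_on U (nabla X Y).
Proof. by move=> oU; exact: (conn_smooth conn oU). Qed.

(** Expand [[X,Y] g(Z,W)] directly and as [X(Y g(Z,W)) - Y(X g(Z,W))]: the mixed products of first
    derivatives are symmetric in [X], [Y] and drop out. *)
Lemma curvature_skew U X Y Z W p : open U -> vfield_on U X -> vfield_on U Y ->
  vfield_on U Z -> vfield_on U W -> U p ->
  <[curvature nabla X Y Z p, W p]>_p + <[Z p, curvature nabla X Y W p]>_p = 0.
Proof.
move=> oU XU YU ZU WU Up.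
have second A B : vfield_on U A -> vfield_on U B ->
    along A (along B (inner g Z W)) p =
    <[nabla A (nabla B Z) p, W p]>_p + <[nabla B Z p, nabla A W p]>_p
    + (<[nabla A Z p, nabla B W p]>_p + <[Z p, nabla A (nabla B W) p]>_p).
  move=> AU BU; have [BZ BW] := (smoothD oU BU ZU, smoothD oU BU WU).
  rewrite -(along_inner oU AU BZ WU Up) -(along_inner oU AU ZU BW Up).
  rewrite -(alongD A oU (smooth_on_inner oU BZ WU) (smooth_on_inner oU ZU BW) Up).
  apply: (along_eq oU Up) => // q Uq; exact: (along_inner oU BU ZU WU Uq).
have E := along_bracket oU XU YU (smooth_on_inner oU ZU WU) Up.
rewrite (second _ _ XU YU) (second _ _ YU XU) in E.
rewrite (along_inner oU (vfield_on_bracket conn tf oU XU YU) ZU WU Up) in E.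
have alg (z w xz yz xw yw xyz yxz xyw yxw b b' : 'rV[R]_n) :
    <[b, w]>_p + <[z, b']>_p =
      <[xyz, w]>_p + <[yz, xw]>_p + (<[xz, yw]>_p + <[z, xyw]>_p)
      - (<[yxz, w]>_p + <[xz, yw]>_p + (<[yz, xw]>_p + <[z, yxw]>_p)) ->
    <[xyz - yxz - b, w]>_p + <[z, xyw - yxw - b']>_p = 0.
  rewrite !(gformDl, gformNl, gformDr, gformNr) => {}E; lra.
exact: alg E.
Qed.

Context (P : vf) (PV : vfield_on setT P) (P_unit : unit_field g P)
  (P_parallel : parallel nabla P).

Local Notation pi := (inner g ^~ P).

Let PU U : vfield_on U P.
Proof. by apply: vfield_on_sub PV. Qed.

Lemma pairing_flat Y : pairing (flat g P) Y = inner g Y P.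
Proof. by apply/funext => p; rewrite /pairing /flat mulmxA. Qed.

Lemma gform_unit p : <[P p, P p]>_p = 1.
Proof. exact: P_unit. Qed.

Lemma gformC_metric p u v : <[u, v]>_p = <[v, u]>_p.
Proof. by rewrite gformC // gram_sym. Qed.

Lemma nabla_parallel U X p : open U -> vfield_on U X -> U p -> nabla X P p = 0.
Proof. by move=> oU XU /mem_set Up; exact: (P_parallel oU XU Up). Qed.

Lemma curvature_parallel U X Y p : open U -> vfield_on U X -> vfield_on U Y ->
  U p -> curvature nabla X Y P p = 0.
Proof.
move=> oU XU YU Up.
have DD0 A B : vfield_on U A -> vfield_on U B -> nabla A (nabla B P) p = 0.
  move=> AU BU; apply: etrans (conn0r conn oU AU Up).
  apply: (conn_eq conn oU AU (smoothD oU BU (@PU U)) _ _ Up) => // q Uq.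
  exact: (nabla_parallel oU BU Uq).
apply: etrans (congr_sub2 (DD0 _ _ XU YU) (DD0 _ _ YU XU)
  (nabla_parallel oU (vfield_on_bracket conn tf oU XU YU) Up)) _.
by rewrite !subr0.
Qed.

Lemma along_pi U X Y p : open U -> vfield_on U X -> vfield_on U Y -> U p ->
  along X (pi Y) p = <[nabla X Y p, P p]>_p.
Proof.
move=> oU XU YU Up; rewrite (along_inner oU XU YU (@PU U) Up).
by rewrite (nabla_parallel oU XU Up) gform0r addr0.
Qed.

Local Notation nbar := (semi_symmetric_metric_connection g nabla P).

Lemma nbarE X Y : nbar X Y =
  (fun p => nabla X Y p + pi Y p *: X p - inner g X Y p *: P p).
Proof. by apply/funext => p; rewrite /nbar pairing_flat. Qed.

(** The coefficients of [X] and [Y] are [-h(Y,Z)] and [h(X,Z)]. That of [P] equals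
    [h(Y,Z) pi(X) - h(X,Z) pi(Y)], the triple products of [pi] cancelling. *)
Lemma curvature_semi_symmetric U X Y Z p : open U -> vfield_on U X ->
  vfield_on U Y -> vfield_on U Z -> U p ->
  curvature nbar X Y Z p = curvature nabla X Y Z p
   + (pi Y p * pi Z p - inner g Y Z p) *: X p
   - (pi X p * pi Z p - inner g X Z p) *: Y p
   + (inner g Y Z p * pi X p - inner g X Z p * pi Y p) *: P p.
Proof.
move=> oU XU YU ZU Up.
have nabla_nbar A B : vfield_on U A -> vfield_on U B ->
    nabla A (nbar B Z) p = nabla A (nabla B Z) p
      + (<[nabla A Z p, P p]>_p *: B p + <[Z p, P p]>_p *: nabla A B p)
      - (<[nabla A B p, Z p]>_p + <[B p, nabla A Z p]>_p) *: P p.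
  move=> AU BU; rewrite nbarE.
  rewrite -(along_pi oU AU ZU Up) -(along_inner oU AU BU ZU Up).
  have E := conn_comb conn oU (smooth_on_inner oU ZU (@PU U))
    (smooth_on_inner oU BU ZU) AU (smoothD oU BU ZU) BU (@PU U) Up.
  rewrite (nabla_parallel oU AU Up) scaler0 addr0 in E.
  exact: E.
have nbar_nbar A B : vfield_on U A -> vfield_on U B ->
    nbar A (nbar B Z) p = nabla A (nabla B Z) p
      + (<[nabla A Z p, P p]>_p *: B p + <[Z p, P p]>_p *: nabla A B p)
      - (<[nabla A B p, Z p]>_p + <[B p, nabla A Z p]>_p) *: P p
      + <[nabla B Z p + <[Z p, P p]>_p *: B p - <[B p, Z p]>_p *: P p, P p]>_p *: A p
      - <[A p, nabla B Z p + <[Z p, P p]>_p *: B p - <[B p, Z p]>_p *: P p]>_p *: P p.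
  move=> AU BU; have VB : nbar B Z p =
      nabla B Z p + <[Z p, P p]>_p *: B p - <[B p, Z p]>_p *: P p by rewrite nbarE.
  by rewrite -(nabla_nbar _ _ AU BU) -VB [in LHS]nbarE.
have nbar_bracket : nbar (bracket X Y) Z p = nabla (bracket X Y) Z p
    + <[Z p, P p]>_p *: (nabla X Y p - nabla Y X p)
    - <[nabla X Y p - nabla Y X p, Z p]>_p *: P p.
  by rewrite nbarE !innerE (bracketE tf oU XU YU Up).
(* Values at [p] become free vectors: [q] is [P], [xy] is [nabla X Y], [xyz] is
   [nabla X (nabla Y Z)], [b] is the derivative of [Z] along the bracket. *)
have alg (x y z q xyz yxz b xy yx xz yz : 'rV[R]_n) : <[q, q]>_p = 1 ->
    xyz + (<[xz, q]>_p *: y + <[z, q]>_p *: xy)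
      - (<[xy, z]>_p + <[y, xz]>_p) *: q
      + <[yz + <[z, q]>_p *: y - <[y, z]>_p *: q, q]>_p *: x
      - <[x, yz + <[z, q]>_p *: y - <[y, z]>_p *: q]>_p *: q
    - (yxz + (<[yz, q]>_p *: x + <[z, q]>_p *: yx)
      - (<[yx, z]>_p + <[x, yz]>_p) *: q
      + <[xz + <[z, q]>_p *: x - <[x, z]>_p *: q, q]>_p *: y
      - <[y, xz + <[z, q]>_p *: x - <[x, z]>_p *: q]>_p *: q)
    - (b + <[z, q]>_p *: (xy - yx) - <[xy - yx, z]>_p *: q)
    = xyz - yxz - b + (<[y, q]>_p * <[z, q]>_p - <[y, z]>_p) *: x
      - (<[x, q]>_p * <[z, q]>_p - <[x, z]>_p) *: y
      + (<[y, z]>_p * <[x, q]>_p - <[x, z]>_p * <[y, q]>_p) *: q.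
  move=> qq; rewrite !(gformDl, gformNl, gformZl, gformDr, gformNr, gformZr) qq.
  rewrite (gformC_metric p y x).
  by apply/rowP => k; rewrite !mxE; ring.
apply: etrans (congr_sub2 (nbar_nbar _ _ XU YU) (nbar_nbar _ _ YU XU) nbar_bracket) _.
exact: alg (gform_unit p).
Qed.

Local Notation S := (ricci nabla).
Local Notation Sbar := (ricci nbar).

(** Origin of [n - 2]: the identity map contributes [n] times [c], and the rank-one terms along [Y]
    and along [P] take away [c] each. *)
Lemma ricci_semi_symmetric U Y Z p : open U -> vfield_on U Y -> vfield_on U Z ->
  U p -> Sbar Y Z p = S Y Z p + (n%:R - 2) * (pi Y p * pi Z p - inner g Y Z p).
Proof.
move=> oU YU ZU Up; set c := pi Y p * pi Z p - inner g Y Z p.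
have sub : U `&` dom (chart_at p) `<=` U by move=> q [].
have oU' : open (U `&` dom (chart_at p)) by apply: openI => //; exact: dom_open.
have Up' : (U `&` dom (chart_at p)) p by split=> //; exact: dom_chart_at.
pose e i : 'rV[R]_n := delta_mx 0 i.
have E i : curvature nbar (coord_field (chart_at p) i) Y Z p 0 i =
    curvature nabla (coord_field (chart_at p) i) Y Z p 0 i + c
    - (<[e i, P p]>_p * Y p 0 i * pi Z p - <[e i, Z p]>_p * Y p 0 i)
    + (inner g Y Z p * (<[e i, P p]>_p * P p 0 i)
       - (<[e i, Z p]>_p * P p 0 i) * pi Y p).
  have eU : vfield_on (U `&` dom (chart_at p)) (coord_field (chart_at p) i).
    apply: (@vfield_on_sub _ _ _ (dom (chart_at p))); first by move=> q [].
    exact: vfield_on_coord_field.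
  have := curvature_semi_symmetric oU' eU (vfield_on_sub sub YU)
    (vfield_on_sub sub ZU) Up'.
  move=> /(congr1 (fun v : 'rV[R]_n => v 0 i)) => Ei; apply: etrans Ei _.
  rewrite !innerE coord_field_chart_at.
  have alg (v y q : 'rV[R]_n) (r s t : R) :
      (v + r *: e i - s *: y + t *: q) 0 i = v 0 i + r - s * y 0 i + t * q 0 i.
    by rewrite !mxE !eqxx mulr1.
  apply: etrans (alg _ _ _ _ _ _) _.
  by rewrite /c !innerE /e; ring.
have sum_alg (r : 'I_n -> R) (y q z : 'rV[R]_n) (k a b t : R) :
    \sum_i (r i + k - (<[e i, q]>_p * y 0 i * b - <[e i, z]>_p * y 0 i)
      + (t * (<[e i, q]>_p * q 0 i) - (<[e i, z]>_p * q 0 i) * a))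
    = \sum_i r i + k * n%:R - (<[y, q]>_p * b - <[y, z]>_p)
      + (t * <[q, q]>_p - <[q, z]>_p * a).
  rewrite !big_split /= !sumrN !big_split /= !sumrN sumr_const card_ord.
  by rewrite -!mulr_suml -mulr_sumr !gform_sum_delta mulr_natr.
rewrite !ricciE; apply: etrans (eq_bigr _ (fun i _ => E i)) _.
apply: etrans (sum_alg _ _ _ _ _ _ _ _) _; rewrite gform_unit.
by rewrite (gformC_metric p (P p)) /c !innerE; ring.
Qed.

Lemma ricci_parallel U Y p : open U -> vfield_on U Y -> U p -> S Y P p = 0.
Proof.
move=> oU YU Up; rewrite ricciE big1 // => i _.
have oU' : open (U `&` dom (chart_at p)) by apply: openI => //; exact: dom_open.
have Up' : (U `&` dom (chart_at p)) p by split=> //; exact: dom_chart_at.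
have eU : vfield_on (U `&` dom (chart_at p)) (coord_field (chart_at p) i).
  apply: (@vfield_on_sub _ _ _ (dom (chart_at p))); first by move=> q [].
  exact: vfield_on_coord_field.
have YU' : vfield_on (U `&` dom (chart_at p)) Y by apply: vfield_on_sub YU => q [].
have E := curvature_parallel oU' eU YU' Up'.
by apply: etrans (congr1 (fun v : 'rV[R]_n => v 0 i) E) _; rewrite mxE.
Qed.

Lemma ricci_form_of_semisymmetric U X W p : curv_ricci_eq_opp_Q g nbar ->
  ricci_semisymmetric nabla -> open U -> vfield_on U X -> vfield_on U W -> U p ->
  S X W p = (n%:R - 2) * (inner g X W p - pi X p * pi W p).
Proof.
move=> RbarSbar RS oU XU0 WU0 Up.
have V0 := @vfield_on0 _ _ M U oU.
(* The hypothesis at [(X0, P; P, W0)], with the values [S(P, .)] still unknown; it is used once to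
   find them and once to conclude. *)
have key X0 W0 : vfield_on U X0 -> vfield_on U W0 ->
    S X0 W0 p - pi X0 p * S P W0 p
    - (n%:R - 2) * (inner g X0 W0 p - pi X0 p * pi W0 p) + pi W0 p * S P X0 p = 0.
  move=> XU WU.
  have VU := vfield_on_curvature conn tf oU XU (@PU U) WU.
  have RP q : U q -> curvature nabla X0 P P q = 0.
    exact: curvature_parallel oU XU (@PU U).
  have RbarW q : U q -> curvature nbar X0 P W0 q = curvature nabla X0 P W0 q.
    move=> Uq; apply: etrans (curvature_semi_symmetric oU XU (@PU U) WU Uq) _.
    have alg (r x w y : 'rV[R]_n) : <[y, y]>_q = 1 ->
        r + (<[y, y]>_q * <[w, y]>_q - <[y, w]>_q) *: x
        - (<[x, y]>_q * <[w, y]>_q - <[x, w]>_q) *: y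
        + (<[y, w]>_q * <[x, y]>_q - <[x, w]>_q * <[y, y]>_q) *: y = r.
      move=> yy; rewrite yy (gformC_metric q y w).
      by apply/rowP => k; rewrite !mxE; ring.
    exact: alg (gform_unit q).
  have RbarP q : U q -> curvature nbar X0 P P q = 0.
    move=> Uq; apply: etrans (curvature_semi_symmetric oU XU (@PU U) (@PU U) Uq) _.
    rewrite (RP q Uq) !innerE gform_unit mulr1 subrr scale0r add0r.
    by rewrite mulr1 mul1r !subrr !scale0r subr0 addr0.
  (* Smoothness of the curvature fields of [nbar] is inherited from the fields they were just shown
     to equal. *)
  have PPU : vfield_on U (curvature nbar X0 P P).
    by apply: (vfield_on_eq oU _ V0) => q Uq; rewrite RbarP.
  have VbarU : vfield_on U (curvature nbar X0 P W0).
    by apply: (vfield_on_eq oU _ VU) => q Uq; rewrite RbarW.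
  (* The correction [h(P, .)] vanishes. Passing to [S] gives access to the locality and linearity
     lemmas, stated for torsion-free connections. *)
  have SbarP Z : vfield_on U Z -> Sbar P Z p = S P Z p.
    move=> ZU; rewrite (ricci_semi_symmetric oU (@PU U) ZU Up) !innerE gform_unit.
    by rewrite mul1r (gformC_metric p (P p)) subrr mulr0 addr0.
  have S0 Z : vfield_on U Z -> S (fun=> 0) Z p = 0 by move=> ZU; exact: (ricci0l conn tf oU ZU Up).
  have SV : S P (curvature nabla X0 P W0) p = 0.
    have := RS U X0 P P W0 oU XU (@PU U) (@PU U) WU p (mem_set Up).
    rewrite /curv_dot /act.
    have -> : S (curvature nabla X0 P P) W0 p = 0.
      apply: etrans (S0 _ WU).
      exact: (ricci_eq conn tf oU (vfield_on_curvature conn tf oU XU (@PU U) (@PU U))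
        WU RP (fun _ _ => erefl) Up).
    by rewrite oppr0 add0r => /eqP; rewrite oppr_eq0 => /eqP.
  have := RbarSbar U X0 P P W0 oU XU (@PU U) (@PU U) WU p (mem_set Up).
  rewrite /curv_dot /Qtensor /act.
  have -> : Sbar (curvature nbar X0 P P) W0 p = 0.
    rewrite (ricci_semi_symmetric oU PPU WU Up) !innerE (RbarP p Up) !gform0l.
    rewrite mul0r subrr mulr0 addr0; apply: etrans (S0 _ WU).
    exact: (ricci_eq conn tf oU PPU WU RbarP (fun _ _ => erefl) Up).
  have -> : Sbar P (curvature nbar X0 P W0) p = 0.
    apply: etrans (SbarP _ VbarU) (etrans _ SV).
    exact: (ricci_eq conn tf oU (@PU U) VbarU (fun _ _ => erefl) RbarW Up).
  have smooth := fun A B (AU : vfield_on U A) (BU : vfield_on U B) =>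
    smooth_on_inner oU AU BU.
  have F1 := vfield_onB oU (vfield_onZ oU (smooth _ _ (@PU U) (@PU U)) XU)
    (vfield_onZ oU (smooth _ _ XU (@PU U)) (@PU U)).
  have F2 := vfield_onB oU (vfield_onZ oU (smooth _ _ (@PU U) WU) XU)
    (vfield_onZ oU (smooth _ _ XU WU) (@PU U)).
  have -> : Sbar (wedge g X0 P P) W0 p = S X0 W0 p - pi X0 p * S P W0 p
      - (n%:R - 2) * (inner g X0 W0 p - pi X0 p * pi W0 p).
    have SF : S (wedge g X0 P P) W0 p = S X0 W0 p - pi X0 p * S P W0 p.
      apply: etrans (ricci_combl conn tf oU (smooth _ _ (@PU U) (@PU U))
        (smooth _ _ XU (@PU U)) XU (@PU U) WU Up) _.
      by rewrite [inner g P P p]gform_unit mul1r.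
    (* [(X /\ P)P] is the component of [X] orthogonal to [P]; pairing it with [w] gives [h(x,w)],
       which is zero for [w = P]. *)
    have perp (x w q : 'rV[R]_n) : <[q, q]>_p = 1 ->
        <[<[q, q]>_p *: x - <[x, q]>_p *: q, w]>_p = <[x, w]>_p - <[x, q]>_p * <[w, q]>_p.
      by move=> qq; rewrite gformDl gformNl !gformZl qq mul1r (gformC_metric p q w).
    have gF : inner g (wedge g X0 P P) W0 p = inner g X0 W0 p - pi X0 p * pi W0 p.
      exact: perp (gform_unit p).
    have piF : pi (wedge g X0 P P) p = 0.
      by apply: etrans (perp _ _ _ (gform_unit p)) _; rewrite gform_unit mulr1 subrr.
    apply: etrans (ricci_semi_symmetric oU F1 WU Up) _.
    by rewrite SF gF piF mul0r sub0r mulrN.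
  have -> : Sbar P (wedge g X0 P W0) p = pi W0 p * S P X0 p - inner g X0 W0 p * S P P p.
    apply: etrans (SbarP _ F2) _.
    apply: etrans (ricci_combr conn tf oU (smooth _ _ (@PU U) WU)
      (smooth _ _ XU WU) (@PU U) XU (@PU U) Up) _.
    by rewrite [inner g P W0 p]gformC_metric.
  have alg (a b c : R) : c = 0 -> - 0 - 0 = - (- a - (b - c)) -> a + b = 0.
    by move=> -> E; lra.
  apply: alg; rewrite (ricci_parallel oU (@PU U) Up); exact: mulr0.
(* In [key] with [W0 = P], both values [S(., P)] vanish by [ricci_parallel] and so does [h(Z,P)];
   only [S(P,Z)] survives. *)
have SP Z : vfield_on U Z -> S P Z p = 0.
  move=> ZU; have := key Z P ZU (@PU U).
  rewrite (ricci_parallel oU ZU Up) (ricci_parallel oU (@PU U) Up) !innerE gform_unit.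
  by rewrite !mulr1 mulr0 !subrr mulr0 subrr mul1r add0r.
have := key X W XU0 WU0; rewrite (SP _ WU0) (SP _ XU0) !mulr0 subr0 addr0.
by move=> /eqP; rewrite subr_eq0 => /eqP.
Qed.

Lemma ricci_semisymmetric_of_form (k : R) :
  (forall U X Y, open U -> vfield_on U X -> vfield_on U Y -> {in U, forall p,
     S X Y p = k * (inner g X Y p - pi X p * pi Y p)}) ->
  ricci_semisymmetric nabla.
Proof.
move=> SE U X Y Z W oU XU YU ZU WU p pU; have Up : U p := set_mem pU.
have RZ := vfield_on_curvature conn tf oU XU YU ZU.
have RW := vfield_on_curvature conn tf oU XU YU WU.
have skew := curvature_skew oU XU YU ZU WU Up.
(* Skewness moves the curvature operator onto [P], which it kills; so the [pi] part of the form
   contributes nothing. *)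
have RP A : vfield_on U A -> <[curvature nabla X Y A p, P p]>_p = 0.
  move=> AU; have := curvature_skew oU XU YU AU (@PU U) Up.
  by rewrite (curvature_parallel oU XU YU Up) gform0r addr0.
rewrite /curv_dot /act (SE U _ _ oU RZ WU p pU) (SE U _ _ oU ZU RW p pU) !innerE.
rewrite (RP _ ZU) (RP _ WU) mul0r mulr0 !subr0 -opprD -mulrDr skew.
by rewrite mulr0 oppr0.
Qed.

(* A nonzero vector orthogonal to [P] has positive norm, so [h] is not zero. *)
Lemma coord_form_neq0 p : (1 < n)%N -> exists i j,
  <[delta_mx 0 i, delta_mx 0 j]>_p - <[delta_mx 0 i, P p]>_p * <[delta_mx 0 j, P p]>_p != 0.
Proof.
move=> n1; apply/not_existsP => none.
pose w : 'cV[R]_n := gram g p *m (P p)^T.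
(* [w] is a single column, of rank at most one, so its kernel is nonzero as soon as [n > 1]. *)
have /rowV0Pn[v /sub_kermxP vw v0] : kermx w != 0.
  rewrite -mxrank_eq0 mxrank_ker -lt0n subn_gt0; apply: leq_ltn_trans n1.
  exact: rank_leq_col.
have vP : <[v, P p]>_p = 0 by rewrite /gform -mulmxA vw mxE.
have := gram_pos g p v0; rewrite -/(gform (gram g p) v v).
(* If [h] vanishes on all basis pairs, then bilinearity gives [h(v,v) = 0]. *)
suff -> : <[v, v]>_p = <[v, P p]>_p * <[v, P p]>_p by rewrite vP mul0r ltxx.
have h0 i j : <[delta_mx 0 i, delta_mx 0 j]>_p =
    <[delta_mx 0 i, P p]>_p * <[delta_mx 0 j, P p]>_p.
  apply/eqP; rewrite -subr_eq0; apply/negPn/negP => ne; apply: (none i).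
  by exists j.
have gsum u : <[v, u]>_p = \sum_i <[delta_mx 0 i, u]>_p * v 0 i.
  by rewrite gform_sum_delta.
rewrite {1}gsum [X in X * _]gsum mulr_suml; apply: eq_bigr => i _.
rewrite gformC_metric gsum gsum [RHS]mulrAC mulr_sumr; congr (_ * _).
by apply: eq_bigr => j _; rewrite gformC_metric h0 mulrA.
Qed.

End SemiSymmetricMetricConnection.

Unset Implicit Arguments.

Theorem theorem4p5 (R : realType) (n : nat) (M : manifold R n) (g : metric M)
    (nabla : (M -> 'rV[R]_n) -> (M -> 'rV[R]_n) -> (M -> 'rV[R]_n))
    (P : M -> 'rV[R]_n)
    (n_ge3 : (3 <= n)%N)
    (nabla_lc : levi_civita g nabla)
    (P_vfield : vfield_on setT P)
    (P_unit : unit_field g P)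
    (P_parallel : parallel nabla P)
    (RbarSbar :
       curv_ricci_eq_opp_Q g (semi_symmetric_metric_connection g nabla P)) :
  (ricci_semisymmetric nabla ->
     quasi_Einstein g (ricci nabla) /\
     ricci_form g (ricci nabla)
       (fun=> (n - 2)%:R) (fun=> - (n - 2)%:R) (flat g P))
  /\
  (ricci_form g (ricci nabla)
     (fun=> (n - 2)%:R) (fun=> - (n - 2)%:R) (flat g P) ->
   ricci_semisymmetric nabla).
Proof.
have formE (x y z : R) : (n - 2)%:R * (x - y * z) = (n - 2)%:R * x + - (n - 2)%:R * (y * z).
  by ring.
split=> [RS|SE]; last first.
  apply: (ricci_semisymmetric_of_form nabla_lc P_vfield P_parallel (k := (n - 2)%:R)).
  move=> U X Y oU XU YU p Up.
  by have := SE U X Y oU XU YU p Up; rewrite !pairing_flat formE.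
(* The statement subtracts in [nat], where subtraction truncates; [n >= 3] makes it agree with the
   [n%:R - 2] produced by the trace. *)
have n2 : (n - 2)%:R = n%:R - 2 :> R by rewrite natrB // ltnW.
have n20 : (n - 2)%:R != 0 :> R by rewrite pnatr_eq0 -lt0n subn_gt0.
have SE U X Y p : open U -> vfield_on U X -> vfield_on U Y -> U p ->
    ricci nabla X Y p = (n - 2)%:R * (inner g X Y p - inner g X P p * inner g Y P p).
  rewrite n2; exact: (ricci_form_of_semisymmetric nabla_lc P_vfield P_unit P_parallel RbarSbar RS).
have form : ricci_form g (ricci nabla)
    (fun=> (n - 2)%:R) (fun=> - (n - 2)%:R) (flat g P).
  move=> U X Y oU XU YU p /set_mem Up.
  by rewrite (SE U X Y p oU XU YU Up) !pairing_flat formE.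
split=> //; split=> //.
(* A pair of coordinate fields at any point witnesses that [S] is not zero: there [S] is [n - 2]
   times a nonzero entry of [h]. *)
- have [p _] := points_nonempty M.
  have [i [j hij]] := coord_form_neq0 g P p (ltnW n_ge3).
  exists (dom (chart_at p)), (coord_field (chart_at p) i), (coord_field (chart_at p) j), p.
  have oc : open (dom (chart_at p)) by exact: dom_open.
  have cp : dom (chart_at p) p := dom_chart_at p.
  have cU k : vfield_on (dom (chart_at p)) (coord_field (chart_at p) k).
    exact: vfield_on_coord_field.
  split; [exact: oc|exact: cU|exact: cU|exact: cp|].
  rewrite (SE _ _ _ _ oc (cU i) (cU j) cp).
  rewrite /inner !coord_field_chart_at.
  by apply/eqP; rewrite mulf_neq0.
- exists (fun=> (n - 2)%:R), (fun=> - (n - 2)%:R), (flat g P); split=> //.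
  + by split; exact: smooth_on_cst.
  + by move=> _; apply/eqP; rewrite oppr_eq0.
  + split=> [U X oU XU|p w0].
      rewrite pairing_flat.
      have PU : vfield_on U P by apply: vfield_on_sub P_vfield.
      exact: (smooth_on_inner g oU XU PU).
    (* If [pi] vanished at [p], then [g(P,P) = pi(P)] would be [0] there instead of [1]. *)
    have := P_unit p; rewrite /inner -mulmxA -/(flat g P p) w0 mulmx0 mxE.
    by move/eqP; rewrite eq_sym oner_eq0.
Qed.
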